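(* Let $a\in\mathbb{C}$ with $|a|<1$ and let $1\le p<\infty$. For all $f\in L^p(\mathbb{T})$, $$\|f-\sigma_n^a(f)\|_p\to0\qquad(n\to\infty).$$
   Context: $\mathbb{T}=\mathbb{R}/2\pi\mathbb{Z}$; functions on $\mathbb{T}$ are real- or complex-valued and identified with $2\pi$-periodic functions on $\mathbb{R}$; $\|f\|_p=\left(\frac1{2\pi}\int_{\mathbb{T}}|f(x)|^p\,dx\right)^{1/p}$. For $a=|a|e^{it_a}$, $|a|<1$, the nonlinear phase function $\theta_a:\mathbb{R}\to\mathbb{R}$ is the continuous function with $e^{i\theta_a(t)}=\dfrac{e^{it}-a}{1-\overline{a}e^{it}}$ (a fixed choice of continuous branch). It is strictly increasing, satisfies $\theta_a(t+2\pi)=\theta_a(t)+2\pi$, and has derivative the Poisson kernel $\theta_a'(t)=p_a(t)=\dfrac{1-|a|^2}{1-2|a|\cos(t-t_a)+|a|^2}$. For $f\in L^1(\mathbb{T})$, $c_k(f)=\dfrac1{2\pi}\displaystyle\int_{-\pi}^{\pi}f(t)e^{-ik\theta_a(t)}p_a(t)\,dt$ for $k\in\mathbb{Z}$, $S_n^a(f)(x)=\displaystyle\sum_{k=-n}^{n}c_k(f)e^{ik\theta_a(x)}$, and the $n$-th Fejér (Cesàro) mean is $\sigma_n^a(f)(x)=\dfrac1{n+1}\displaystyle\sum_{k=0}^{n}S_k^a(f)(x)$. *)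

(* Defs.v *)
From mathcomp Require Import all_boot all_order all_algebra.
From mathcomp Require Import complex.
From mathcomp Require Import all_classical all_reals all_analysis.

Set Implicit Arguments.
Unset Strict Implicit.
Unset Printing Implicit Defensive.

Import Order.TTheory GRing.Theory Num.Theory.
Import numFieldTopology.Exports numFieldNormedType.Exports.
Import Normc.

Local Open Scope classical_set_scope.
Local Open Scope complex_scope.
Local Open Scope ring_scope.

(* Functions on the circle R/2piZ are 2pi-periodic functions R -> R[i];
   real-valued ones are those with zero imaginary part. *)

Section NonlinearFejer.
Variable R : realType.
Implicit Types (a : R[i]) (f : R -> R[i]) (theta : R -> R).

Local Notation mu := (@lebesgue_measure R).

Definition expi (t : R) : R[i] := cos t +i* sin t.

(* R[i] carries no integral in the library: integrate componentwise.  The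
   real-valued integral is 0 when an improper value would arise, but it is
   only used on integrable functions here. *)
Definition cintegral (D : set R) f : R[i] :=
  (\int[mu]_(t in D) complex.Re (f t)) +i* (\int[mu]_(t in D) complex.Im (f t)).

(* The p-norm for the normalised measure dx / 2pi, as an extended real. *)
Definition circle_norm (p : R) f : \bar R :=
  (((2 * pi)^-1)%R%:E
     * \int[mu]_(x in `[(- pi)%R, pi%R]) (normc (f x) `^ p)%R%:E) `^ (p^-1)%R.

(* Borel representatives; every class of L^p(R/2piZ) has one. *)
Definition in_Lp (p : R) f : Prop :=
  [/\ forall t, f (t + 2 * pi) = f t,
      measurable_fun setT (fun t => complex.Re (f t)),
      measurable_fun setT (fun t => complex.Im (f t)) &
      (circle_norm p f < +oo)%E].

(* A continuous branch of the argument of (e^it - a) / (1 - conj(a) e^it);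
   it is determined by a up to an additive multiple of 2pi. *)
Definition nonlinear_phase a theta : Prop :=
  continuous theta /\
  forall t, expi (theta t) = (expi t - a) / (1 - a^* * expi t).

(* ta is an argument of a, i.e. a = |a| e^(i ta); if a = 0 any ta will do. *)
Definition is_arg a (ta : R) : Prop := a = (normc a)%:C * expi ta.

Definition poisson a (ta t : R) : R :=
  (1 - normc a ^+ 2) / (1 - 2 * normc a * cos (t - ta) + normc a ^+ 2).

Definition coef a ta theta f (k : int) : R[i] :=
  ((2 * pi)^-1)%:C *
  cintegral `[- pi, pi]
    (fun t => f t * expi (- (k%:~R * theta t)) * (poisson a ta t)%:C).

(* The index j in [0, 2n] stands for k = j - n in [-n, n]. *)
Definition partial_sum a ta theta f (n : nat) (x : R) : R[i] :=
  \sum_(0 <= j < n.*2.+1)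
    coef a ta theta f (j%:Z - n%:Z) * expi ((j%:Z - n%:Z)%:~R * theta x).

Definition fejer_mean a ta theta f (n : nat) (x : R) : R[i] :=
  (n.+1%:R)^-1 * \sum_(0 <= k < n.+1) partial_sum a ta theta f k x.

End NonlinearFejer.

(* Main.v *)
Require Import Defs.
From mathcomp Require Import all_boot all_order all_algebra.
From mathcomp Require Import complex ring lra.
From mathcomp Require Import all_classical all_reals all_analysis.
From mathcomp Require Import measurable_realfun.

Set Implicit Arguments.
Unset Strict Implicit.
Unset Printing Implicit Defensive.

Import Order.TTheory GRing.Theory Num.Theory.
Import numFieldTopology.Exports numFieldNormedType.Exports.
Import Normc.

Local Open Scope classical_set_scope.
Local Open Scope complex_scope.
Local Open Scope ring_scope.

(** Both [exp (i k theta(x))] and the coefficients see the phase [theta] only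
    through [exp (i theta)], so [theta] may be replaced by an explicit function
    [phase] built from [atan], whose derivative is the Poisson kernel [p_a] and
    which grows by [2 pi] over a period ([expi_nonlinear_phase],
    [is_derive_phase], [phaseD2pi]).  Summing the geometric progressions then
    turns the Fejer mean into an average against a real kernel,
[[
    sigma_n f (x) = 1 / (2 pi) * int f(t) F_n(phase x - phase t) p_a(t) dt,
]]
    where [F_n] is the classical Fejer kernel ([fejer_mean_kernel]).  As this
    kernel is real, the real and imaginary parts of [f] can be treated
    separately.

    These averages form an approximate identity on the interval from [-pi] to [pi].
    - The kernel is nonnegative and of mass 1 in [t], because
      [F_n(phase x - phase t) p_a(t)] is minus the derivative of a primitive of [F_n]
      composed with the phase, and that primitive grows by [2 pi] over a period
      ([integral_phase_kernel]).
    - [F_n] is even and [p_a] lies between two positive constants; exchanging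
      [x] and [t] therefore costs only a factor, and the mass in [x] is bounded
      ([phase_kernel_adjoint]).
    - The identity
      [1 - cos (phase x - phase t) = p_a(x) p_a(t) (1 - cos (x - t))], combined
      with [(1 - cos u) F_n(u) = (1 - cos ((n + 1) u)) / (n + 1)], makes the
      kernel tend to 0 away from the diagonal ([phase_kernel_concentrates]).

    For any such kernel the averages converge to [h] in [L^p]
    ([approximate_identity_Lp]).  Jensen's inequality and Tonelli's theorem give
    a bound on [L^p] uniform in [n] ([Lp_mass_kernel_mean_le]); bounded
    continuous functions are dense ([Lp_dense_bounded_continuous]); and for
    those the averages converge at every interior point of the interval, hence
    in [L^p] by dominated convergence.  Since only interior points matter, the
    approximating continuous functions need not be periodic. *)

(** * Powers, and limits of nonnegative extended reals *)

Section Powers.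
Context {R : realType}.
Implicit Types (p s m x y : R).

(** The convex function [s |-> s `^ p] lies above its tangent at [m]; this is
    Young's inequality between [s] and [m `^ (p - 1)]. *)
Lemma powR_tangent p s m : 1 <= p -> 0 <= s -> 0 <= m ->
  p * m `^ (p - 1) * s - (p - 1) * m `^ p <= s `^ p.
Proof.
move=> p1 s0 m0; have p0 : 0 < p by rewrite (lt_le_trans _ p1).
have [->|pn1] := eqVneq p 1.
  by rewrite !subrr powRr0 mul0r !mul1r subr0 powRr1.
have q0 : 0 < p - 1 by rewrite subr_gt0 lt_neqAle eq_sym pn1.
have := @conjugate_powR R s (m `^ (p - 1)) p (p / (p - 1)) s0 (powR_ge0 _ _) p0.
rewrite -powRrM mulrCA divff ?gt_eqF// mulr1 => H.
have {}H := H (divr_gt0 p0 q0) ltac:(by rewrite invf_div; field; rewrite gt_eqF).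
rewrite lerBlDr mulrAC -mulrA -ler_pdivlMl//.
apply: le_trans H _.
rewrite le_eqVlt; apply/orP; left; apply/eqP; field.
by rewrite !gt_eqF.
Qed.

Lemma powR_addr_le p x y : 0 <= p -> 0 <= x -> 0 <= y ->
  (x + y) `^ p <= 2 `^ p * (x `^ p + y `^ p).
Proof.
move=> p0; wlog xy : x y / x <= y.
  move=> H x0 y0; have [/H|/ltW /H] := leP x y; first exact.
  by rewrite addrC [y `^ p + _]addrC; exact.
move=> x0 y0; apply: (@le_trans _ _ ((2 * y) `^ p)).
  by apply: ge0_ler_powR; rewrite ?nnegrE ?addr_ge0 ?mulr_ge0//; lra.
by rewrite powRM// ler_wpM2l ?powR_ge0// lerDr powR_ge0.
Qed.

Lemma le_1DpowR p x : 1 <= p -> 0 <= x -> x <= 1 + x `^ p.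
Proof.
move=> p1 x0; have [x1|/ltW x1] := leP x 1.
  by rewrite (le_trans x1)// lerDl powR_ge0.
by rewrite (le_trans (le1r_powR x1 p1))// lerDr.
Qed.

Lemma nneg_cvge0P (u : (\bar R)^nat) : (forall n, 0 <= u n)%E ->
  u n @[n --> \oo] --> 0%E <->
  forall e : R, 0 < e -> \forall n \near \oo, (u n <= e%:E)%E.
Proof.
move=> u0; split=> [/fine_cvgP[ufin /cvgrPdist_le uc] e e0|H].
  near=> n.
  have un : u n \is a fin_num by near: n.
  rewrite -(fineK un) lee_fin.
  have : `|0 - fine (u n)| <= e by near: n; exact: uc.
  by rewrite sub0r normrN ger0_norm// fine_ge0.
apply/fine_cvgP; split.
  near=> n; rewrite ge0_fin_numE//; apply: (@le_lt_trans _ _ 1%:E).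
    by near: n; exact: H.
  by rewrite ltry.
apply/cvgrPdist_le => e e0; near=> n.
have ue : (u n <= e%:E)%E by near: n; exact: H.
rewrite sub0r normrN ger0_norm ?fine_ge0//.
by rewrite -lee_fin fineK// ge0_fin_numE// (le_lt_trans ue) ?ltry.
Unshelve. all: by end_near. Qed.
End Powers.

(** * Parametric integrals over a measurable set *)

Section ParametricIntegral.
Context {R : realType}.
Local Notation mu := (@lebesgue_measure R).
Variables (D : set R) (mD : measurable D).
Implicit Types (f : R * R -> \bar R).

Lemma measurable_parametric_integral f : measurable_fun setT f ->
  (forall z, 0 <= f z)%E ->
  measurable_fun setT (fun x => \int[mu]_(t in D) f (x, t))%E.
Proof.
move=> mf f0.
rewrite (_ : (fun _ => _) = fubini_F mu (f \_ (setT `*` D))); last first.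
  apply/funext => x; rewrite integral_mkcond; apply: eq_integral => t _.
  by rewrite /patch in_setX in_setT.
apply: measurable_fun_fubini_tonelli_F.
  apply/(measurable_restrictT f (measurableX measurableT mD)).
  exact: measurable_funTS.
by move=> z; rewrite patchE; case: ifP.
Qed.

Lemma tonelli_on f : measurable_fun setT f -> (forall z, 0 <= f z)%E ->
  (\int[mu]_(x in D) \int[mu]_(t in D) f (x, t) =
   \int[mu]_(t in D) \int[mu]_(x in D) f (x, t))%E.
Proof.
move=> mf f0.
pose g := f \_ (D `*` D).
have mg : measurable_fun setT g.
  apply/(measurable_restrictT f (measurableX mD mD)).
  exact: measurable_funTS.
have g0 z : (0 <= g z)%E by rewrite /g patchE; case: ifP.
have := @fubini_tonelli _ _ _ _ _ mu mu g mg g0.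
have -> : (\int[mu]_x \int[mu]_t g (x, t) =
    \int[mu]_(x in D) \int[mu]_(t in D) f (x, t))%E.
  rewrite [RHS]integral_mkcond; apply: eq_integral => x _.
  rewrite [RHS]patchE; case: ifPn => xD.
    rewrite [RHS]integral_mkcond; apply: eq_integral => t _.
    by rewrite /g /patch in_setX xD.
  by apply: integral0_eq => t _; rewrite /g /patch in_setX (negbTE xD).
move=> ->.
rewrite [RHS]integral_mkcond; apply: eq_integral => t _.
rewrite [RHS]patchE; case: ifPn => tD.
  rewrite [RHS]integral_mkcond; apply: eq_integral => x _.
  by rewrite /g /patch in_setX tD andbT.
by apply: integral0_eq => x _; rewrite /g /patch in_setX (negbTE tD) andbF.
Qed.
End ParametricIntegral.

(** * The p-th power of the L^p norm *)

Section LpMass.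
Context {R : realType}.
Local Notation mu := (@lebesgue_measure R).
Variables (D : set R) (mD : measurable D) (p : R).
Implicit Types h g : R -> R.

(** The root is left out: this quantity is subadditive up to the factor
    [2 `^ p], which is all that the limit arguments need. *)
Definition Lp_mass h : \bar R := (\int[mu]_(t in D) (`|h t| `^ p)%:E)%E.

Lemma Lp_mass_ge0 h : (0 <= Lp_mass h)%E.
Proof. by apply: integral_ge0 => t _; rewrite lee_fin powR_ge0. Qed.

Lemma measurable_powR_norm h : measurable_fun setT h ->
  measurable_fun setT (fun t => `|h t| `^ p).
Proof.
move=> mh; apply: (measurableT_comp (measurable_powR p)).
exact: measurableT_comp.
Qed.

Lemma measurable_Lp_integrand h : measurable_fun setT h ->
  measurable_fun D (fun t => (`|h t| `^ p)%:E).
Proof.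
move=> mh; apply/measurable_EFinP; apply: measurable_funTS.
exact: measurable_powR_norm.
Qed.

Lemma Lp_mass_le h g : measurable_fun setT h -> measurable_fun setT g ->
  0 <= p -> (forall t, D t -> `|h t| <= `|g t|) -> (Lp_mass h <= Lp_mass g)%E.
Proof.
move=> mh mg p0 hg; apply: ge0_le_integral => //.
- exact: measurable_Lp_integrand.
- exact: measurable_Lp_integrand.
- by move=> t Dt; rewrite lee_fin ge0_ler_powR ?nnegrE// hg.
Qed.

Lemma Lp_mass_le_add h g1 g2 : measurable_fun setT h ->
  measurable_fun setT g1 -> measurable_fun setT g2 -> 0 <= p ->
  (forall t, D t -> `|h t| <= `|g1 t| + `|g2 t|) ->
  (Lp_mass h <= (2 `^ p)%:E * (Lp_mass g1 + Lp_mass g2))%E.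
Proof.
move=> mh mg1 mg2 p0 hg.
have m1 := measurable_Lp_integrand mg1; have m2 := measurable_Lp_integrand mg2.
have n0 g : forall t, D t -> (0 <= (`|g t| `^ p)%:E)%E.
  by move=> t _; rewrite lee_fin powR_ge0.
rewrite /Lp_mass -ge0_integralD// -ge0_integralZl ?lee_fin ?powR_ge0//; last 2 first.
- exact: emeasurable_funD.
- by move=> t Dt; rewrite adde_ge0 ?lee_fin ?powR_ge0.
apply: ge0_le_integral => //.
- exact: measurable_Lp_integrand.
- by apply: emeasurable_funM => //; exact: emeasurable_funD.
move=> t Dt; rewrite -EFinD -EFinM lee_fin.
apply: le_trans (powR_addr_le _ _ _) => //.
by rewrite ge0_ler_powR ?nnegrE ?addr_ge0 ?hg.
Qed.

Lemma Lp_integrable_powR h : measurable_fun setT h -> (Lp_mass h < +oo)%E ->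
  mu.-integrable D (fun t => (`|h t| `^ p)%:E).
Proof.
move=> mh hoo; apply/integrableP; split; first exact: measurable_Lp_integrand.
by under eq_integral do rewrite gee0_abs ?lee_fin ?powR_ge0//.
Qed.

Lemma integrable_bounded_on h M : (mu D < +oo)%E -> measurable_fun setT h ->
  (forall t, `|h t| <= M) -> mu.-integrable D (EFin \o h).
Proof.
move=> Doo mh hM.
apply: measurable_bounded_integrable => //; first exact: measurable_funTS.
exists M; split; first exact: num_real.
by move=> y My t _ /=; rewrite (le_trans _ (ltW My)).
Qed.

Lemma Lp_integrable h : (mu D < +oo)%E -> 1 <= p ->
  measurable_fun setT h -> (Lp_mass h < +oo)%E ->
  mu.-integrable D (EFin \o h).
Proof.
move=> Doo p1 mh hoo.
apply: (@le_integrable _ _ _ mu D mD _ (fun t => (1 + `|h t| `^ p)%:E)).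
- exact/measurable_EFinP/measurable_funTS.
- move=> t Dt; rewrite /= lee_fin [leRHS]ger0_norm ?addr_ge0 ?powR_ge0//.
  exact: le_1DpowR.
- under eq_fun do rewrite EFinD.
  apply: integrableD => //; last exact: Lp_integrable_powR.
  by apply: (@integrable_bounded_on (fun=> 1) 1) => // t; rewrite normr1.
Qed.
End LpMass.

(** * Averages against a probability kernel *)

Section KernelMean.
Context {R : realType}.
Local Notation mu := (@lebesgue_measure R).
Variables (D : set R) (mD : measurable D) (muD : (mu D < +oo)%E).
Variables (k : R -> R -> R).
Hypothesis k_ge0 : forall x t, 0 <= k x t.
Hypothesis k_meas : measurable_fun setT (fun z : R * R => k z.1 z.2).
Hypothesis k_bounded : forall x, exists B, forall t, k x t <= B.
Hypothesis k_mean : forall x, D x -> \int[mu]_(t in D) k x t = 1.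
Implicit Types h g : R -> R.

Definition kernel_mean h x : R := \int[mu]_(t in D) (h t * k x t).

Lemma measurable_kernel x : measurable_fun setT (k x).
Proof. exact: (measurable_fun_pair2 x k_meas). Qed.

Lemma integrable_mul_kernel h x : mu.-integrable D (EFin \o h) ->
  mu.-integrable D (EFin \o (fun t => h t * k x t)).
Proof.
move=> ih; rewrite (_ : _ \o _ = (EFin \o h) \* (EFin \o k x))%E//.
apply: integrableMl => //; first by apply: measurable_funTS; exact: measurable_kernel.
have [B kB] := k_bounded x.
exists B; split; first exact: num_real.
by move=> M BM t _ /=; rewrite ger0_norm// (le_trans (kB t))// ltW.
Qed.

Lemma integrable_cst_on (c : R) : mu.-integrable D (EFin \o (fun=> c)).
Proof.
exact: (@integrable_bounded_on _ _ mD (fun=> c) `|c|).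
Qed.

Lemma kernel_mean_cst c x : D x -> kernel_mean (fun=> c) x = c.
Proof.
move=> Dx; rewrite /kernel_mean RintegralZl// ?k_mean ?mulr1//.
have := @integrable_mul_kernel (fun=> 1) x (integrable_cst_on 1).
by under eq_fun do rewrite /= mul1r.
Qed.

Lemma kernel_meanB h g x : mu.-integrable D (EFin \o h) ->
  mu.-integrable D (EFin \o g) ->
  kernel_mean (fun t => h t - g t) x = kernel_mean h x - kernel_mean g x.
Proof.
move=> ih ig; rewrite /kernel_mean -RintegralB//; try exact: integrable_mul_kernel.
by apply: eq_Rintegral => t _; rewrite mulrBl.
Qed.

Lemma kernel_mean_le h g x : mu.-integrable D (EFin \o h) ->
  mu.-integrable D (EFin \o g) -> (forall t, D t -> h t <= g t) ->
  kernel_mean h x <= kernel_mean g x.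
Proof.
move=> ih ig hg; apply: le_Rintegral => //; try exact: integrable_mul_kernel.
by move=> t Dt; rewrite ler_wpM2r// hg.
Qed.

Lemma norm_kernel_mean_le h x : mu.-integrable D (EFin \o h) ->
  `|kernel_mean h x| <= kernel_mean (fun t => `|h t|) x.
Proof.
move=> ih; apply: le_trans (le_normr_Rintegral _ _) _ => //.
  exact: integrable_mul_kernel.
by under eq_Rintegral do rewrite normrM (ger0_norm (k_ge0 _ _)).
Qed.

(** Jensen's inequality: average the tangent inequality at the point
    [m = kernel_mean |h|]; the average of the tangent line at [m] is
    [m `^ p] since the kernel has mass 1. *)
Lemma kernel_mean_jensen p h x : 1 <= p -> D x -> measurable_fun setT h ->
  (Lp_mass D p h < +oo)%E ->
  `|kernel_mean h x| `^ p <= kernel_mean (fun t => `|h t| `^ p) x.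
Proof.
move=> p1 Dx mh hoo.
have ih := Lp_integrable mD muD p1 mh hoo.
have ihp := Lp_integrable_powR mh hoo.
have ian : mu.-integrable D (EFin \o (fun t => `|h t|)).
  exact: integrable_norm ih.
pose m := kernel_mean (fun t => `|h t|) x.
have m0 : 0 <= m by apply: Rintegral_ge0 => t _; rewrite mulr_ge0.
apply: (@le_trans _ _ (m `^ p)).
  apply: ge0_ler_powR; rewrite ?nnegrE ?(le_trans ler01 p1)//.
  exact: norm_kernel_mean_le.
pose c : R := p * m `^ (p - 1).
have ic : mu.-integrable D (EFin \o (fun t => c * `|h t|)).
  rewrite (_ : _ \o _ = (fun t : R => c%:E * (`|h t|%R)%:E)%E); last first.
    by apply/funext => t; rewrite /= EFinM.
  exact: integrableZl.
have -> : m `^ p = kernel_mean (fun t => c * `|h t| - (p - 1) * m `^ p) x.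
  rewrite kernel_meanB//; last exact: integrable_cst_on.
  rewrite kernel_mean_cst//.
  rewrite /kernel_mean; under eq_Rintegral do rewrite -mulrA.
  rewrite RintegralZl//; last exact: integrable_mul_kernel.
  rewrite -/(kernel_mean _ x) -/m /c -mulrA [_ `^ _ * m]mulrC.
  rewrite mulr_powRB1 ?(lt_le_trans ltr01 p1)//; ring.
apply: kernel_mean_le => //.
  have -> : EFin \o (fun t => c * `|h t| - (p - 1) * m `^ p) =
    (fun t => (c * `|h t|)%R%:E - ((p - 1) * m `^ p)%R%:E)%E by [].
  by apply: integrableB => //; exact: integrable_cst_on.
by move=> t _; exact: powR_tangent.
Qed.
End KernelMean.

Section KernelMeanLp.
Context {R : realType}.
Local Notation mu := (@lebesgue_measure R).
Variables (D : set R) (mD : measurable D) (muD : (mu D < +oo)%E).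
Variables (k : R -> R -> R).
Hypothesis k_ge0 : forall x t, 0 <= k x t.
Hypothesis k_meas : measurable_fun setT (fun z : R * R => k z.1 z.2).
Hypothesis k_bounded : forall x, exists B, forall t, k x t <= B.
Hypothesis k_mean : forall x, D x -> \int[mu]_(t in D) k x t = 1.
Implicit Types h g : R -> R.
Local Notation T := (kernel_mean D k).

Lemma measurable_mul_kernel2 h : measurable_fun setT h ->
  measurable_fun setT (fun z : R * R => h z.2 * k z.1 z.2).
Proof.
move=> mh; apply: measurable_funM => //.
exact: (measurableT_comp mh measurable_snd).
Qed.

(** Tonelli's theorem gives measurability for nonnegative functions only, and
    [h = (|h| + h) - |h|] is a difference of two nonnegative integrable ones. *)
Lemma measurable_kernel_mean h : measurable_fun setT h ->
  mu.-integrable D (EFin \o h) -> measurable_fun setT (T h).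
Proof.
move=> mh ih.
pose F g x := (\int[mu]_(t in D) (g t * k x t)%:E)%E.
have mF g : measurable_fun setT g -> (forall t, 0 <= g t) ->
    measurable_fun setT (fine \o F g).
  move=> mg g0; apply: measurableT_comp; first exact: fine_measurable.
  apply: (@measurable_parametric_integral _ D mD
    (fun z => (g z.2 * k z.1 z.2)%:E)).
    by apply/measurable_EFinP; exact: measurable_mul_kernel2.
  by move=> z; rewrite lee_fin mulr_ge0.
have ian : mu.-integrable D (EFin \o (fun t => `|h t|)).
  exact: integrable_norm ih.
have isum : mu.-integrable D (EFin \o (fun t => `|h t| + h t)).
  rewrite (_ : _ \o _ = (fun t : R => (`|h t|%R)%:E + (h t)%:E)%E)//.
  exact: integrableD.
rewrite (_ : T h = fun x => fine (F (fun t => `|h t| + h t) x) -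
    fine (F (fun t => `|h t|) x)); last first.
  apply/funext => x; rewrite -[LHS]/(kernel_mean D k h x).
  rewrite -[RHS]/(T (fun t => `|h t| + h t) x - T (fun t => `|h t|) x).
  rewrite -kernel_meanB//; apply: eq_Rintegral => t _.
  by rewrite addrAC subrr add0r.
have mn : measurable_fun setT (fun t => `|h t|) by exact: measurableT_comp.
apply: measurable_funB; apply: mF => //.
  exact: measurable_funD.
by move=> t; have := ler_norm (- h t); rewrite normrN; lra.
Qed.

(** Jensen's inequality bounds the left side by a double integral; after
    exchanging the order, the mass of the kernel in its first variable
    factors out. *)
Lemma Lp_mass_kernel_mean_le p (C : R) h :
  (forall t, D t -> (\int[mu]_(x in D) (k x t)%:E <= C%:E)%E) ->
  0 <= C -> 1 <= p -> measurable_fun setT h -> (Lp_mass D p h < +oo)%E ->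
  (Lp_mass D p (T h) <= C%:E * Lp_mass D p h)%E.
Proof.
move=> kC C0 p1 mh hoo.
have ih := Lp_integrable mD muD p1 mh hoo.
have ihp := Lp_integrable_powR mh hoo.
have mT := measurable_kernel_mean mh ih.
pose f (z : R * R) := ((`|h z.2| `^ p) * k z.1 z.2)%:E.
have mf : measurable_fun setT f.
  apply/measurable_EFinP.
  apply: (@measurable_mul_kernel2 (fun t => `|h t| `^ p)).
  exact: measurable_powR_norm.
have f0 z : (0 <= f z)%E by rewrite lee_fin mulr_ge0 ?powR_ge0.
have H1 : (Lp_mass D p (T h) <= \int[mu]_(x in D) \int[mu]_(t in D) f (x, t))%E.
  apply: ge0_le_integral => //.
  - exact: measurable_Lp_integrand.
  - apply: measurable_funTS.
    exact: (@measurable_parametric_integral _ D mD f mf f0).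
  move=> x Dx; apply: (@le_trans _ _ (kernel_mean D k (fun t => `|h t| `^ p) x)%:E).
    by rewrite lee_fin; exact: kernel_mean_jensen.
  rewrite /kernel_mean /Rintegral fineK//.
  apply: integrable_fin_num => //.
  exact: (@integrable_mul_kernel _ _ mD k k_ge0 k_meas k_bounded (fun t => `|h t| `^ p)).
apply: (le_trans H1); rewrite tonelli_on//.
have mk t : measurable_fun setT (k ^~ t).
  exact: (measurable_fun_pair1 t k_meas).
rewrite /Lp_mass -ge0_integralZl//; last exact: measurable_Lp_integrand.
apply: ge0_le_integral => //.
- by move=> t _; apply: integral_ge0.
- apply: measurable_funTS.
  apply: (@measurable_parametric_integral _ D mD (fun z => f (z.2, z.1))) => //.
  by apply: (measurableT_comp mf); apply: measurable_fun_pair.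
- by apply: measurable_funeM; exact: measurable_Lp_integrand.
move=> t Dt; rewrite /f /=.
under eq_integral do rewrite EFinM.
rewrite ge0_integralZl//.
- by rewrite muleC lee_wpmul2r ?lee_fin ?powR_ge0// kC.
- by apply/measurable_EFinP; apply: measurable_funTS; exact: mk.
- by move=> x _; rewrite lee_fin.
Qed.
End KernelMeanLp.

(** * Density of bounded continuous functions in L^p *)

Section Clamp.
Context {R : realType}.
Implicit Types M x y : R.

Definition clamp M x : R := Num.max (- M) (Num.min M x).

Lemma norm_clamp_le M x : 0 <= M -> `|clamp M x| <= M.
Proof.
move=> M0; rewrite ler_norml /clamp le_max lexx /= ge_max ge_min lexx andbT.
by rewrite ge0_cp.
Qed.

Lemma clamp_id M x : `|x| <= M -> clamp M x = x.
Proof.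
rewrite ler_norml /clamp => /andP[xM Mx].
by rewrite (min_idPr Mx) (max_idPr xM).
Qed.

Lemma clamp_lipschitz M x y : `|clamp M x - clamp M y| <= `|x - y|.
Proof.
rewrite /clamp !maxEle !minEle ler_norml.
case: ifP; case: ifP; case: ifP; case: ifP; do ?[move=> /negbT; rewrite -ltNge];
 case: (ger0P (x - y)); lra.
Qed.

Lemma clamp_contract M x : 0 <= M -> `|x - clamp M x| <= `|x|.
Proof.
move=> M0; rewrite /clamp maxEle minEle ler_norml.
case: ifP; case: ifP; do ?[move=> /negbT; rewrite -ltNge];
 case: (ger0P x); lra.
Qed.

Lemma continuous_clamp M : continuous (clamp M).
Proof.
move=> x; apply/cvgrPdist_le => e e0; near=> y.
apply: le_trans (clamp_lipschitz _ _ _) _.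
by near: y; exact: cvgr_dist_le.
Unshelve. all: by end_near. Qed.
End Clamp.

Section Density.
Context {R : realType}.
Local Notation mu := (@lebesgue_measure R).
Variables (D : set R) (mD : measurable D) (muD : (mu D < +oo)%E).
Variables (p : R) (p1 : 1 <= p).
Implicit Types h g : R -> R.

Let p0 : 0 < p. Proof. exact: lt_le_trans p1. Qed.

Lemma Lp_mass_truncate h : measurable_fun setT h -> (Lp_mass D p h < +oo)%E ->
  Lp_mass D p (fun t => h t - clamp n%:R (h t)) @[n --> \oo] --> 0%E.
Proof.
move=> mh hoo.
have mhn n : measurable_fun setT (fun t => h t - clamp n%:R (h t)).
  apply: measurable_funB => //; apply: measurableT_comp => //.
  by apply: continuous_measurable_fun; exact: continuous_clamp.
pose F n t := (`|h t - clamp n%:R (h t)| `^ p)%:E.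
have F0 : {ae mu, forall t, D t -> F n t @[n --> \oo] --> 0%E}.
  apply: aeW => t _; apply: cvg_near_cst; near=> n.
  rewrite /F clamp_id ?subrr ?normr0 ?powR0 ?gt_eqF//.
  by near: n; exact: nbhs_infty_ger.
have Fh : {ae mu, forall t n, D t -> (`|F n t| <= (`|h t| `^ p)%:E)%E}.
  apply: aeW => t n _; rewrite gee0_abs ?lee_fin ?powR_ge0//.
  by rewrite ge0_ler_powR ?nnegrE ?(ltW p0)// clamp_contract.
have mF n : measurable_fun D (F n) by exact: measurable_Lp_integrand.
have [_ _] := @dominated_convergence _ _ R mu D mD F (cst 0%E) _ mF (@measurable_cst _ _ _ _ _ _)
  F0 (Lp_integrable_powR mh hoo) Fh.
by rewrite integral0.
Unshelve. all: by end_near. Qed.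

(** For uniformly bounded functions convergence in [L^1] implies convergence in [L^p]. *)
Lemma Lp_mass_bounded_le h (M : R) : measurable_fun setT h ->
  (forall t, D t -> `|h t| <= M) ->
  (Lp_mass D p h <= (M `^ (p - 1))%:E * \int[mu]_(t in D) (`|h t|%R)%:E)%E.
Proof.
move=> mh hM.
have mn : measurable_fun D (fun t => (`|h t|)%:E).
  apply/measurable_EFinP; apply: measurable_funTS; exact: measurableT_comp.
rewrite -ge0_integralZl ?lee_fin ?powR_ge0//.
apply: ge0_le_integral => //.
- exact: measurable_Lp_integrand.
- exact: measurable_funeM.
move=> t Dt; rewrite -EFinM lee_fin -(mulr_powRB1 _ p0)// mulrC.
rewrite ler_wpM2r// ge0_ler_powR ?nnegrE ?subr_ge0//; last exact: hM.
by rewrite (le_trans _ (hM _ Dt)).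
Qed.

(** Truncate [h] at a level [M], approximate the truncation in [L^1] by a
    continuous function and clamp the latter at [M].  Clamping does not increase
    the distance to the truncation and keeps the difference below [2 M], where
    the [L^1] bound is also an [L^p] bound. *)
Lemma Lp_dense_bounded_continuous h (e : R) : measurable_fun setT h ->
  (Lp_mass D p h < +oo)%E -> 0 < e ->
  exists g (M : R), [/\ continuous g, forall t, `|g t| <= M &
    (Lp_mass D p (fun t => h t - g t)%R <= e%:E)%E].
Proof.
move=> mh hoo e0.
pose e1 := e / (2 `^ p) / 2.
have e10 : 0 < e1 by rewrite !divr_gt0// powR_gt0.
have /nneg_cvge0P trunc := Lp_mass_truncate mh hoo.
have [|N _ HN] := trunc _ _ e10; first by move=> n; exact: Lp_mass_ge0.
pose M : R := N%:R; pose hM t := clamp M (h t).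
have M0 : 0 <= M by [].
have mhM : measurable_fun setT hM.
  apply: measurableT_comp => //.
  by apply: continuous_measurable_fun; exact: continuous_clamp.
have ihM : mu.-integrable D (EFin \o hM).
  by apply: (integrable_bounded_on mD muD mhM) => t; exact: norm_clamp_le.
have [G [cG _ /nneg_cvge0P GC]] := approximation_continuous_integrable mD muD ihM.
(* The [+ 1] keeps the denominator positive when [M = 0]. *)
pose e2 := e1 / ((2 * M) `^ (p - 1) + 1).
have e20 : 0 < e2 by rewrite divr_gt0// ltr_wpDl ?powR_ge0.
have [|n _ /(_ n (leqnn n)) /= Hn] := GC _ _ e20; first by move=> n; exact: integral_ge0.
pose g t := clamp M (G n t).
have cg : continuous g.
  by move=> t; exact: (continuous_comp (cG n t) (@continuous_clamp R M (G n t))).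
have mg := continuous_measurable_fun cg.
exists g, M; split => //; first by move=> t; exact: norm_clamp_le.
have mB1 : measurable_fun setT (fun t => h t - hM t) by exact: measurable_funB.
have mB2 : measurable_fun setT (fun t => hM t - g t) by exact: measurable_funB.
have H2 : (Lp_mass D p (fun t => hM t - g t)%R <= e1%:E)%E.
  apply: (@le_trans _ _ _ _ _ (@Lp_mass_bounded_le (fun t => hM t - g t) (2 * M) mB2 _)).
    move=> t _; rewrite (le_trans (ler_normB _ _))// mulrDl mul1r.
    by rewrite lerD// norm_clamp_le.
  apply: (@le_trans _ _ (((2 * M) `^ (p - 1))%:E * e2%:E)%E).
    apply: lee_wpmul2l; first by rewrite lee_fin powR_ge0.
    apply: le_trans Hn.
    apply: ge0_le_integral => //.
    - apply/measurable_EFinP; apply: measurable_funTS; exact: measurableT_comp.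
    - apply: measurable_funTS; apply/measurable_EFinP; apply: measurableT_comp => //.
      apply: measurable_funB => //; apply: continuous_measurable_fun; exact: cG.
    - move=> t _; rewrite lee_fin /g -{1}[hM t](@clamp_id _ M) ?norm_clamp_le//.
      exact: clamp_lipschitz.
  rewrite -EFinM lee_fin /e2 mulrCA ger_pMr// ler_pdivrMr ?mul1r ?ltr_wpDl ?powR_ge0//.
  by rewrite lerDl.
apply: (le_trans (@Lp_mass_le_add _ D mD p _ _ _ (measurable_funB mh mg) mB1 mB2 (ltW p0) _)).
  by move=> t _; rewrite /= -[h t - g t](subrKA (hM t)) ler_normD.
apply: (@le_trans _ _ ((2 `^ p)%:E * (e1%:E + e1%:E))%E).
  apply: lee_wpmul2l; first by rewrite lee_fin powR_ge0.
  by apply: leeD; [exact: (HN N (leqnn N))|exact: H2].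
rewrite -EFinD -EFinM lee_fin /e1 -splitr mulrC divfK// gt_eqF// powR_gt0//.
Qed.
End Density.

(** * Approximate identities on an interval *)

Section ApproximateIdentity.
Context {R : realType}.
Local Notation mu := (@lebesgue_measure R).
Variables (a b : R) (ab : a < b).
Local Notation D := (`[a, b]%classic : set R).
Variables (K : nat -> R -> R -> R) (C : R).
Hypothesis K_ge0 : forall n x t, 0 <= K n x t.
Hypothesis K_meas : forall n, measurable_fun setT (fun z : R * R => K n z.1 z.2).
Hypothesis K_bounded : forall n x, exists B, forall t, K n x t <= B.
Hypothesis K_mean : forall n x, \int[mu]_(t in D) K n x t = 1.
Hypothesis C_ge0 : 0 <= C.
Hypothesis K_adjoint : forall n t, D t ->
  (\int[mu]_(x in D) (K n x t)%:E <= C%:E)%E.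
Hypothesis K_concentrates : forall x d e, a < x < b -> 0 < d -> 0 < e ->
  \forall n \near \oo, forall t, D t -> d <= `|x - t| -> K n x t <= e.
Implicit Types h g : R -> R.
Local Notation T n := (kernel_mean D (K n)).

Let mD : measurable D. Proof. exact: measurable_itv. Qed.
Let muDE : mu D = (b - a)%:E.
Proof. by rewrite lebesgue_measure_itv /= lte_fin ab EFinB. Qed.
Let muD : (mu D < +oo)%E. Proof. by rewrite muDE ltry. Qed.

(** The integrand [|g x - g t| K_n(x, t)] is at most [eps / 2 * K_n(x, t)] near
    the diagonal, by continuity, and at most a small constant away from it, by
    concentration.  The sum of the two bounds holds everywhere, so the domain
    need not be split. *)
Lemma kernel_mean_cvg g M x : measurable_fun setT g ->
  (forall t, `|g t| <= M) -> {for x, continuous g} -> a < x < b ->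
  T n g x @[n --> \oo] --> g x.
Proof.
move=> mg gM cg axb; apply/cvgrPdist_le => e e0.
have Dx : D x by rewrite /= in_itv /=; case/andP: axb => *; rewrite !ltW.
have M0 : 0 <= M by rewrite (le_trans _ (gM x)).
have e20 : 0 < e / 2 by rewrite divr_gt0.
have /cvgrPdist_le /(_ _ e20) [d /= d0 Hd] := cg.
pose c := 2 * M + 1; have c0 : 0 < c by rewrite ltr_wpDl// mulr_ge0.
have ba0 : 0 < b - a by rewrite subr_gt0.
pose e1 := e / 2 / c / (b - a).
have e10 : 0 < e1 by rewrite !divr_gt0.
have := K_concentrates axb d0 e10; apply: filterS => n Kn.
have icst (r : R) : mu.-integrable D (EFin \o (fun=> r)) by exact: integrable_cst_on.
have ig : mu.-integrable D (EFin \o g) by exact: (integrable_bounded_on mD muD mg gM).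
have iK h : mu.-integrable D (EFin \o h) ->
    mu.-integrable D (EFin \o (fun t => h t * K n x t)).
  by move=> ih; apply: integrable_mul_kernel.
have ign : mu.-integrable D (EFin \o (fun t => g x - g t)).
  rewrite (_ : _ \o _ = (fun t : R => (g x)%:E - (g t)%:E)%E)//.
  by apply: integrableB => //; exact: icst.
have iaK : mu.-integrable D (EFin \o (fun t => `|g x - g t| * K n x t)).
  by apply: iK; exact: integrable_norm ign.
rewrite -{1}(@kernel_mean_cst _ _ mD muD (K n) (K_ge0 n) (K_meas n) (K_bounded n)
  (fun y _ => K_mean n y) (g x) x Dx) -kernel_meanB//.
apply: le_trans (norm_kernel_mean_le _ _ _ _ _ _) _ => //.
apply: (@le_trans _ _ (\int[mu]_(t in D) (e / 2 * K n x t + c * e1))).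
  apply: le_Rintegral => //.
    rewrite (_ : _ \o _ = (fun t : R => (e / 2 * K n x t)%R%:E + (c * e1)%R%:E)%E)//.
    by apply: integrableD => //; [exact: (iK _ (icst _))|exact: icst].
  move=> t Dt; have [dt|dt] := ltP `|x - t| d.
    apply: ler_wpDr; first by rewrite mulr_ge0// ltW.
    by rewrite ler_wpM2r// Hd.
  apply: ler_wpDl; first by rewrite mulr_ge0// ltW.
  apply: ler_pM => //; last exact: Kn.
  rewrite (le_trans (ler_normB _ _))// /c.
  by have := gM x; have := gM t; lra.
rewrite RintegralD//; last exact: (iK _ (icst _)).
rewrite RintegralZl//; last first.
  have := iK _ (icst 1); rewrite (_ : (fun t => 1 * K n x t) = K n x)//.
  by apply/funext => t; rewrite mul1r.
rewrite K_mean mulr1 Rintegral_cst// (_ : fine _ = b - a); last exact: (congr1 fine muDE).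
have -> : c * e1 * (b - a) = e / 2.
  by rewrite /e1; field; rewrite !gt_eqF.
by rewrite -splitr.
Qed.

Variables (p : R) (p1 : 1 <= p).
Let p0 : 0 < p. Proof. exact: lt_le_trans p1. Qed.

(** Dominated convergence on the open interval: at its endpoints the averages
    may fail to converge, as a periodic kernel also charges the other end. *)
Lemma Lp_mass_continuous_cvg g M : continuous g -> (forall t, `|g t| <= M) ->
  Lp_mass D p (fun t => g t - T n g t) @[n --> \oo] --> 0%E.
Proof.
move=> cg gM; have mg := continuous_measurable_fun cg.
have M0 : 0 <= M by rewrite (le_trans _ (gM 0)).
have ig : mu.-integrable D (EFin \o g) by exact: (integrable_bounded_on mD muD mg gM).
have mT n : measurable_fun setT (fun t => g t - T n g t).
  by apply: measurable_funB => //; exact: measurable_kernel_mean.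
pose F n t := (`|g t - T n g t| `^ p)%:E.
have mF n : measurable_fun setT (F n).
  by apply/measurable_EFinP; exact: measurable_powR_norm.
pose D' := `]a, b[%classic : set R.
have mD' : measurable D' by exact: measurable_itv.
have D'D t : D' t -> D t by exact: subset_itv_oo_cc.
have F0 : {ae mu, forall t, D' t -> F n t @[n --> \oo] --> 0%E}.
  apply: aeW => t; rewrite /D' /= in_itv /= => abt.
  apply/nneg_cvge0P => [n|e e0]; first by rewrite lee_fin powR_ge0.
  have e1 : 0 < e `^ p^-1 by rewrite powR_gt0.
  have /cvgrPdist_le /(_ _ e1) := kernel_mean_cvg mg gM (cg t) abt.
  apply: filterS => n; rewrite lee_fin => H.
  have -> : e = (e `^ p^-1) `^ p.
    by rewrite -powRrM mulVf ?gt_eqF// powRr1// ltW.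
  by rewrite ge0_ler_powR ?nnegrE ?powR_ge0// ltW.
have FM : {ae mu, forall t n, D' t -> (`|F n t| <= cst (((2 * M) `^ p)%:E) t)%E}.
  apply: aeW => t n /D'D Dt; rewrite gee0_abs ?lee_fin ?powR_ge0//.
  rewrite /cst ge0_ler_powR ?nnegrE ?(ltW p0) ?mulr_ge0//.
  rewrite (le_trans (ler_normB _ _))// mulrDl mul1r lerD//.
  apply: le_trans (norm_kernel_mean_le _ _ _ _ _ _) _ => //.
  rewrite -[leRHS](@kernel_mean_cst _ _ mD muD (K n) (K_ge0 n) (K_meas n) (K_bounded n)
    (fun y _ => K_mean n y) M t Dt).
  apply: kernel_mean_le => //; first exact: integrable_norm ig.
  exact: integrable_cst_on.
have iM : mu.-integrable D' (cst (((2 * M) `^ p)%:E)).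
  have := integrable_cst_on mD muD ((2 * M) `^ p); exact: integrableS.
have [_ _] := @dominated_convergence _ _ R mu D' mD' F (cst 0%E) _
  (fun n => measurable_funTS (mF n)) (@measurable_cst _ _ _ _ _ _) F0 iM FM.
rewrite integral0; apply: cvg_trans; apply: near_eq_cvg; near=> n.
rewrite /= /Lp_mass (@integral_itv_bndoo R a b _ true false)//; exact: (measurable_funTS (mF n)).
Unshelve. all: by end_near. Qed.

(** Write [h - T h = (h - g) + (g - T g) + T (g - h)] with [g] continuous and
    close to [h]; the uniform bound controls the last term. *)
Theorem approximate_identity_Lp h : measurable_fun setT h ->
  (Lp_mass D p h < +oo)%E ->
  Lp_mass D p (fun t => h t - T n h t) @[n --> \oo] --> 0%E.
Proof.
move=> mh hoo; apply/nneg_cvge0P => [n|e e0]; first exact: Lp_mass_ge0.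
pose c : R := 2 `^ p; have c0 : 0 < c by rewrite powR_gt0.
(* The two triangle inequalities give [c * (e1 + c * (e1 + C * e1))]. *)
pose e1 := e / (c + c * c * C + c * c).
have e10 : 0 < e1.
  apply: divr_gt0 => //; apply: ltr_wpDl; last by rewrite mulr_gt0.
  by rewrite addr_ge0 ?mulr_ge0// ltW.
have [g [M [cg gM hg]]] := Lp_dense_bounded_continuous mD muD p1 mh hoo e10.
have mg := continuous_measurable_fun cg.
have ig : mu.-integrable D (EFin \o g) by exact: (integrable_bounded_on mD muD mg gM).
have ih := Lp_integrable mD muD p1 mh hoo.
have mgh : measurable_fun setT (fun t => g t - h t) by exact: measurable_funB.
have mhg : measurable_fun setT (fun t => h t - g t) by exact: measurable_funB.
have hgE : Lp_mass D p (fun t => g t - h t) = Lp_mass D p (fun t => h t - g t).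
  by apply: eq_integral => t _; rewrite distrC.
have ghoo : (Lp_mass D p (fun t => g t - h t)%R < +oo)%E.
  by rewrite hgE (le_lt_trans hg)// ltry.
have igh : mu.-integrable D (EFin \o (fun t => g t - h t)).
  exact: (Lp_integrable mD muD p1 mgh ghoo).
have /nneg_cvge0P gcv := Lp_mass_continuous_cvg cg gM.
have [|N _ HN] := gcv _ _ e10; first by move=> n; exact: Lp_mass_ge0.
exists N => // n Nn /=.
have mTh : measurable_fun setT (T n h) by exact: measurable_kernel_mean.
have mTg : measurable_fun setT (T n g) by exact: measurable_kernel_mean.
have mTgh : measurable_fun setT (T n (fun t => g t - h t)).
  exact: measurable_kernel_mean.
have mgT : measurable_fun setT (fun t => g t - T n g t) by exact: measurable_funB.
have mgTh : measurable_fun setT (fun t => g t - T n h t) by exact: measurable_funB.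
have mhT : measurable_fun setT (fun t => h t - T n h t) by exact: measurable_funB.
have H1 := Lp_mass_le_add mD mhT mhg mgTh (ltW p0) _.
have H2 := Lp_mass_le_add mD mgTh mgT mTgh (ltW p0) _.
have H3 := Lp_mass_kernel_mean_le mD muD (K_ge0 n) (K_meas n) (K_bounded n)
  (fun y _ => K_mean n y) (K_adjoint n) C_ge0 p1 mgh ghoo.
apply: le_trans (H1 _) _.
  by move=> t _; rewrite -[h t - T n h t](subrKA (g t)) ler_normD.
apply: (@le_trans _ _ (c%:E * (e1%:E + c%:E * (e1%:E + C%:E * e1%:E)))%E).
  apply: lee_wpmul2l; first by rewrite lee_fin ltW.
  apply: leeD; first exact: hg.
  apply: le_trans (H2 _) _.
    move=> t _; rewrite kernel_meanB// -[g t - T n h t](subrKA (T n g t)).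
    exact: ler_normD.
  apply: lee_wpmul2l; first by rewrite lee_fin ltW.
  apply: leeD; first exact: (HN n).
  by apply: le_trans H3 _; rewrite hgE; apply: lee_wpmul2l; rewrite ?lee_fin.
rewrite -!(EFinM, EFinD) lee_fin.
have s0 : 0 < c + c * c * C + c * c.
  by rewrite ltr_wpDl ?mulr_gt0// ltW// ltr_wpDr ?mulr_ge0 ?(ltW c0).
rewrite le_eqVlt; apply/orP; left; apply/eqP; rewrite /e1.
by field; rewrite gt_eqF.
Qed.
End ApproximateIdentity.

(** * The classical Fejer kernel *)

Section FejerKernel.
Context {R : realType}.
Implicit Types (u x t : R) (k n : nat).

Definition dirichlet k u : R := 1 + 2 * \sum_(j < k) cos (j.+1%:R * u).

Definition fejer n u : R := n.+1%:R^-1 * \sum_(k < n.+1) dirichlet k u.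

Lemma dirichletS k u :
  dirichlet k.+1 u = dirichlet k u + 2 * cos (k.+1%:R * u).
Proof. by rewrite /dirichlet big_ord_recr /= mulrDr addrA. Qed.

(** Multiplied by [1 - cos u], the Dirichlet kernels telescope, which yields
    the closed form of the Fejer kernel. *)
Lemma dirichlet_telescope k u :
  (1 - cos u) * dirichlet k u = cos (k%:R * u) - cos (k.+1%:R * u).
Proof.
elim: k => [|k IH].
  by rewrite /dirichlet big_ord0 mulr0 addr0 mulr1 mul0r cos0 mul1r.
rewrite dirichletS mulrDr IH.
have -> : k%:R * u = k.+1%:R * u - u by rewrite -natr1; ring.
have -> : k.+2%:R * u = k.+1%:R * u + u by rewrite -[k.+2%:R]natr1; ring.
rewrite cosB cosD; ring.
Qed.

Lemma fejer_closed n u :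
  (1 - cos u) * fejer n u = n.+1%:R^-1 * (1 - cos (n.+1%:R * u)).
Proof.
rewrite /fejer mulrCA mulr_sumr; congr (_ * _).
under eq_bigr do rewrite dirichlet_telescope.
rewrite -(big_mkord xpredT (fun k => cos (k%:R * u) - cos (k.+1%:R * u))).
rewrite -[LHS]opprK -sumrN.
under eq_bigr do rewrite opprB.
by rewrite telescope_sumr// mul0r cos0 opprB.
Qed.

Lemma cosMn_eq1 k u : cos u = 1 -> cos (k%:R * u) = 1.
Proof.
move=> cu; have su : sin u = 0.
  by apply/eqP; rewrite -sqrf_eq0 sin2cos2 cu expr1n subrr.
elim: k => [|k IH]; first by rewrite mul0r cos0.
by rewrite -natr1 mulrDl mul1r cosD su mulr0 subr0 IH cu mulr1.
Qed.

(** The closed form settles the case [cos u <> 1]; when [cos u = 1] every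
    term of the sum is nonnegative. *)
Lemma fejer_ge0 n u : 0 <= fejer n u.
Proof.
have [cu|cu] := eqVneq (cos u) 1.
  rewrite mulr_ge0// sumr_ge0// => k _.
  rewrite addr_ge0// mulr_ge0// sumr_ge0// => j _.
  by rewrite cosMn_eq1.
have cu0 : 0 < 1 - cos u by rewrite subr_gt0 lt_neqAle cu cos_le1.
by rewrite -(pmulr_rge0 _ cu0) fejer_closed mulr_ge0// subr_ge0 cos_le1.
Qed.

Lemma fejer_le n u (e : R) : 0 < e -> e <= 1 - cos u ->
  fejer n u <= 2 / e / n.+1%:R.
Proof.
move=> e0 eu; have cu := lt_le_trans e0 eu.
rewrite -(ler_pM2l cu) fejer_closed.
rewrite mulrA [leRHS]mulrC ler_pM2l ?invr_gt0//.
apply: (@le_trans _ _ 2); first by have := cos_geN1 (n.+1%:R * u); lra.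
by rewrite mulrCA ler_peMr// ler_pdivlMr// mul1r.
Qed.

Lemma dirichletN k u : dirichlet k (- u) = dirichlet k u.
Proof.
by rewrite /dirichlet; under eq_bigr do rewrite mulrN cosN.
Qed.

Lemma fejerN n u : fejer n (- u) = fejer n u.
Proof.
by rewrite /fejer; under eq_bigr do rewrite dirichletN.
Qed.

Lemma derivable_dirichlet k (u : R) : derivable (dirichlet k) u 1.
Proof.
elim: k => [|k IH].
  rewrite (_ : dirichlet 0 = cst 1); first exact: derivable_cst.
  by apply/funext => v; rewrite /dirichlet big_ord0 mulr0 addr0.
rewrite (_ : dirichlet k.+1 = dirichlet k + (fun v => 2 * cos (k.+1%:R * v))).
  by apply: derivableD => //; exact: ex_derive.
by apply/funext => v; rewrite dirichletS.
Qed.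

Lemma derivable_continuous (F : R -> R) :
  (forall x, derivable F x 1) -> continuous F.
Proof.
by move=> dF x; apply/differentiable_continuous; rewrite -derivable1_diffP.
Qed.

Lemma continuous_fejer n : continuous (fejer n).
Proof.
apply: derivable_continuous => u.
rewrite (_ : fejer n = n.+1%:R^-1 \*: \sum_(k < n.+1) dirichlet k).
  apply: derivableZ; apply: derivable_sum => k; exact: derivable_dirichlet.
by apply/funext => v; rewrite /fejer /= fct_sumE.
Qed.

Lemma dirichlet_le k (u : R) : dirichlet k u <= 1 + 2 * k%:R.
Proof.
rewrite lerD2l ler_wpM2l// (le_trans (ler_sum _ (G := fun=> 1) _))//.
by rewrite sumr_const card_ord.
Qed.

Lemma fejer_bounded n (u : R) : fejer n u <= 1 + 2 * n%:R.
Proof.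
rewrite /fejer ler_pdivrMl//.
apply: (@le_trans _ _ (\sum_(k < n.+1) (1 + 2 * n%:R))).
  apply: ler_sum => k _; apply: le_trans (dirichlet_le _ _) _.
  by rewrite lerD2l ler_wpM2l// ler_nat -ltnS.
by rewrite sumr_const card_ord -[leLHS]mulr_natl.
Qed.

(** The linear term, which comes from the constant coefficient of the kernel,
    is the only part of this primitive that is not periodic: the primitive grows
    by [2 pi] over a period. *)
Definition dirichlet_primitive k u : R :=
  u + 2 * \sum_(j < k) (j.+1%:R)^-1 * sin (j.+1%:R * u).

Definition fejer_primitive n u : R :=
  n.+1%:R^-1 * \sum_(k < n.+1) dirichlet_primitive k u.

Lemma is_derive_dirichlet_primitive k u :
  is_derive u 1 (dirichlet_primitive k) (dirichlet k u).
Proof.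
elim: k => [|k IH].
  rewrite /dirichlet big_ord0 mulr0 addr0.
  rewrite (_ : dirichlet_primitive 0 = id); first exact: is_derive_id.
  by apply/funext => v; rewrite /dirichlet_primitive big_ord0 mulr0 addr0.
rewrite dirichletS.
rewrite (_ : dirichlet_primitive k.+1 = (dirichlet_primitive k) +
   (fun v => 2 * (k.+1%:R^-1 * sin (k.+1%:R * v)))); last first.
  by apply/funext => v; rewrite /= /dirichlet_primitive big_ord_recr /= fctE; ring.
apply: is_deriveD.
apply: trigger_derive.
rewrite /GRing.scale /= !mulr1 ?mulr0 ?addr0 ?add0r.
by field; rewrite nat1r pnatr_eq0.
Qed.

Lemma is_derive_fejer_primitive n u :
  is_derive u 1 (fejer_primitive n) (fejer n u).
Proof.
rewrite (_ : fejer_primitive n =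
    n.+1%:R^-1 \*: \sum_(k < n.+1) dirichlet_primitive k); last first.
  by apply/funext => v; rewrite /fejer_primitive /= fct_sumE.
apply: is_deriveZ; apply: is_derive_sum => k.
exact: is_derive_dirichlet_primitive.
Qed.

Lemma dirichlet_primitiveD2pi k u :
  dirichlet_primitive k (u + 2 * pi) = dirichlet_primitive k u + 2 * pi.
Proof.
rewrite /dirichlet_primitive addrAC; congr (_ + _ + _).
congr (_ * _); apply: eq_bigr => j _.
have -> : j.+1%:R * (u + 2 * pi) = j.+1%:R * u + (pi *+ 2) *+ j.+1.
  by rewrite mulrDr !mulr_natl.
by rewrite (periodicn (@sinD2pi R)).
Qed.

Lemma fejer_primitiveD2pi n u :
  fejer_primitive n (u + 2 * pi) = fejer_primitive n u + 2 * pi.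
Proof.
rewrite /fejer_primitive; under eq_bigr do rewrite dirichlet_primitiveD2pi.
rewrite big_split/= sumr_const card_ord mulrDr; congr (_ + _).
by rewrite -[X in _ * X]mulr_natl mulKf// pnatr_eq0.
Qed.
End FejerKernel.

(** * An explicit nonlinear phase *)

Section Phase.
Context {R : realType}.
Variables (r ta : R).
Hypothesis (r0 : 0 <= r) (r1 : r < 1).
Implicit Types (x t : R).

(** With [q = 1 - r exp (i (t - ta))], the Moebius factor is
    [exp (i t) * conj q / q], and [- arg q] is the arctangent below because
    [q] has positive real part. *)
Definition phase t : R :=
  t + 2 * atan (r * sin (t - ta) / (1 - r * cos (t - ta))).

Definition poisson_den t : R := 1 - 2 * r * cos (t - ta) + r ^+ 2.

(** The Poisson kernel of the point of modulus [r] and argument [ta]. *)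
Definition poissonr t : R := (1 - r ^+ 2) / poisson_den t.

Lemma poisson_num_gt0 : 0 < 1 - r ^+ 2.
Proof. by rewrite subr_gt0 expr_lt1. Qed.

Lemma one_minus_rcos_gt0 x : 0 < 1 - r * cos x.
Proof.
by rewrite subr_gt0 (le_lt_trans _ r1)// ler_piMr// cos_le1.
Qed.

Lemma poisson_den_ge t : (1 - r) ^+ 2 <= poisson_den t.
Proof.
have : r * cos (t - ta) <= r by rewrite ler_piMr// cos_le1.
by rewrite /poisson_den => h; nra.
Qed.

Lemma poisson_den_gt0 t : 0 < poisson_den t.
Proof.
apply: lt_le_trans (poisson_den_ge t).
by rewrite exprn_gt0// subr_gt0.
Qed.

Lemma poisson_den_le4 t : poisson_den t <= 4.
Proof.
have h : - r <= r * cos (t - ta) by rewrite -mulrN1 ler_wpM2l// cos_geN1.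
have h2 : r ^+ 2 <= 1 by rewrite expr_le1// ltW.
by have := r1; rewrite /poisson_den; lra.
Qed.

Lemma poisson_den_sq t :
  poisson_den t = (1 - r * cos (t - ta)) ^+ 2 + (r * sin (t - ta)) ^+ 2.
Proof. by rewrite exprMn sin2cos2 /poisson_den; ring. Qed.

Lemma poissonr_ge t : (1 - r ^+ 2) / 4 <= poissonr t.
Proof.
rewrite ler_wpM2l ?(ltW poisson_num_gt0)// lef_pV2 ?posrE ?poisson_den_gt0//.
exact: poisson_den_le4.
Qed.

Lemma poissonr_le t : poissonr t <= (1 - r ^+ 2) / (1 - r) ^+ 2.
Proof.
rewrite ler_wpM2l ?(ltW poisson_num_gt0)// lef_pV2 ?posrE ?poisson_den_gt0//.
  exact: poisson_den_ge.
by rewrite exprn_gt0// subr_gt0.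
Qed.

Lemma poissonr_gt0 t : 0 < poissonr t.
Proof. by rewrite divr_gt0 ?poisson_den_gt0 ?poisson_num_gt0. Qed.

Lemma is_derive_phase t : is_derive t 1 phase (poissonr t).
Proof.
have q0 := one_minus_rcos_gt0 (t - ta).
have q1 := lt0r_neq0 q0.
have D0 := lt0r_neq0 (poisson_den_gt0 t).
pose q : R -> R := fun t => 1 - r * cos (t - ta).
pose y : R -> R := fun t => r * sin (t - ta) * (q t)^-1.
have dq : is_derive t 1 q (r * sin (t - ta)).
  apply: trigger_derive.
  by rewrite /GRing.scale /= ?(mulr1, mulr0, addr0, add0r, subr0, sub0r); ring.
have dy : is_derive t 1 y ((r * cos (t - ta) - r ^+ 2) / q t ^+ 2).
  have dV := @is_deriveV R q t _ 1 q1 dq.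
  apply: trigger_derive.
  rewrite /GRing.scale /= ?(mulr1, mulr0, addr0, add0r, subr0, sub0r).
  have hr : r ^+ 2 = r ^+ 2 * (cos (t - ta) ^+ 2 + sin (t - ta) ^+ 2).
    by rewrite cos2Dsin2 mulr1.
  by rewrite [r ^+ 2 in RHS]hr /q; field.
have -> : phase = id + (2 \*: (atan \o y)) by [].
apply: is_derive_eq.
rewrite /GRing.scale /= /poissonr.
have -> : 1 + y t ^+ 2 = poisson_den t / q t ^+ 2.
  by rewrite poisson_den_sq /y /q; field.
by rewrite /poisson_den /q; field; rewrite q1 andbT.
Qed.

Lemma phaseD2pi t : phase (t + 2 * pi) = phase t + 2 * pi.
Proof.
rewrite /phase (_ : t + 2 * pi - ta = (t - ta) + pi *+ 2); last first.
  by rewrite -mulr_natl; ring.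
by rewrite sinD2pi cosD2pi addrAC.
Qed.

(** These are the real and imaginary parts of
    [exp (- i ta) (exp (i t) - a) / (1 - conj a exp (i t))] for
    [a = r exp (i ta)], rationalised. *)
Lemma cos_sin_phase t :
  cos (phase t - ta) = ((1 + r ^+ 2) * cos (t - ta) - 2 * r) / poisson_den t /\
  sin (phase t - ta) = (1 - r ^+ 2) * sin (t - ta) / poisson_den t.
Proof.
have q1 := lt0r_neq0 (one_minus_rcos_gt0 (t - ta)).
have D0 := lt0r_neq0 (poisson_den_gt0 t).
pose y := r * sin (t - ta) / (1 - r * cos (t - ta)).
have -> : phase t - ta = (t - ta) + (atan y + atan y) by rewrite /phase; ring.
have cy0 : cos (atan y) != 0.
  by rewrite lt0r_neq0// cos_gt0_pihalf// atan_gtNpi2 atan_ltpi2.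
have sy : sin (atan y) = y * cos (atan y).
  by rewrite -{2}(atanK y) /tan divfK.
(* The half-angle is [atan y], so only [cos (atan y) ^ 2] is needed. *)
have cy2 : cos (atan y) ^+ 2 = (1 - r * cos (t - ta)) ^+ 2 / poisson_den t.
  have : cos (atan y) ^+ 2 * (1 + y ^+ 2) = 1.
    by rewrite mulrDr mulr1 -exprMn [_ * y]mulrC -sy cos2Dsin2.
  have -> : 1 + y ^+ 2 = poisson_den t / (1 - r * cos (t - ta)) ^+ 2.
    by rewrite poisson_den_sq /y; field.
  by rewrite mulrA => /divr1_eq h; apply: (canRL (mulfK D0)).
rewrite (cosD (t - ta)) (sinD (t - ta)) (cosD (atan y)) (sinD (atan y)) sy.
set A := cos (atan y) in cy2 *.
set c := cos (t - ta); set s := sin (t - ta).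
have hs : s ^+ 2 = 1 - c ^+ 2 by exact: sin2cos2.
split.
  transitivity (A ^+ 2 * (c * (1 - y ^+ 2) - 2 * s * y)); first by ring.
  rewrite cy2 mulrAC; congr (_ / _); rewrite /y -/c -/s.
  transitivity (c * ((1 - r * c) ^+ 2 - r ^+ 2 * s ^+ 2) -
     2 * r * s ^+ 2 * (1 - r * c)); first by field.
  by rewrite hs; ring.
transitivity (A ^+ 2 * (s * (1 - y ^+ 2) + 2 * c * y)); first by ring.
rewrite cy2 mulrAC; congr (_ / _); rewrite /y -/c -/s.
transitivity (s * ((1 - r * c) ^+ 2 - r ^+ 2 * s ^+ 2 +
   2 * r * c * (1 - r * c))); first by field.
by rewrite hs; ring.
Qed.

(** The conformal factor of a Moebius map: squared chord lengths on the circle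
    are multiplied by the product of the derivatives at the two endpoints. *)
Lemma one_minus_cos_phase x t :
  1 - cos (phase x - phase t) = poissonr x * poissonr t * (1 - cos (x - t)).
Proof.
have -> : phase x - phase t = (phase x - ta) - (phase t - ta) by ring.
have -> : x - t = (x - ta) - (t - ta) by ring.
rewrite (cosB (x - ta)) (cosB (phase x - ta)).
have [-> ->] := cos_sin_phase x; have [-> ->] := cos_sin_phase t.
have := lt0r_neq0 (poisson_den_gt0 x); have := lt0r_neq0 (poisson_den_gt0 t).
rewrite /poissonr /poisson_den => Dt Dx.
by field; rewrite Dx Dt.
Qed.
End Phase.

(** * The Fejer kernel in the nonlinear phase *)

Section PhaseKernel.
Context {R : realType}.
Local Notation mu := (@lebesgue_measure R).
Variables (r ta : R).
Hypotheses (r0 : 0 <= r) (r1 : r < 1).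
Implicit Types (x t : R) (n k : nat).
Local Notation D := (`[- pi, pi]%classic : set R).
Local Notation phi := (phase r ta).
Local Notation pk := (poissonr r ta).

Lemma continuous_phase : continuous phi.
Proof.
by apply: derivable_continuous => x; case: (is_derive_phase ta r0 r1 x).
Qed.

Lemma continuous_poissonr : continuous pk.
Proof.
move=> t; apply: cvgM; first exact: cvg_cst.
apply: cvgV; first by rewrite gt_eqF// poisson_den_gt0.
move: t; apply: derivable_continuous => t; exact: ex_derive.
Qed.

Definition phase_kernel n x t : R := fejer n (phi x - phi t) * pk t / (2 * pi).

Let pi2 : 0 < 2 * pi :> R. Proof. by rewrite mulr_gt0// pi_gt0. Qed.

Lemma phase_kernel_ge0 n x t : 0 <= phase_kernel n x t.
Proof.
by rewrite /phase_kernel divr_ge0 ?(ltW pi2)// mulr_ge0 ?fejer_ge0// ltW// poissonr_gt0.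
Qed.

Lemma measurable_phase_kernel n :
  measurable_fun setT (fun z : R * R => phase_kernel n z.1 z.2).
Proof.
have mphi := continuous_measurable_fun continuous_phase.
apply: measurable_funM => //; apply: measurable_funM.
  apply: (measurableT_comp (continuous_measurable_fun (@continuous_fejer R n))).
  by apply: measurable_funB; apply: (measurableT_comp mphi).
exact: (measurableT_comp (continuous_measurable_fun continuous_poissonr)).
Qed.

Lemma phase_kernel_bounded n x : exists B, forall t, phase_kernel n x t <= B.
Proof.
exists ((1 + 2 * n%:R) * ((1 - r ^+ 2) / (1 - r) ^+ 2) / (2 * pi)) => t.
rewrite ler_pM2r ?invr_gt0// ler_pM ?fejer_ge0 ?fejer_bounded ?poissonr_le//.
by rewrite ltW// poissonr_gt0.
Qed.

(** The change of variables [u = phase t] is carried out on primitives; the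
    growth of the phase by [2 pi] over a period gives the total mass. *)
Lemma integral_phase_kernel n x :
  (\int[mu]_(t in D) (phase_kernel n x t)%:E)%E = 1%E.
Proof.
pose F : R -> R := fun t => - (fejer_primitive n (phi x - phi t)) / (2 * pi).
have dF t : is_derive t 1 F (phase_kernel n x t).
  have dp := is_derive_phase ta r0 r1 t.
  have dP := is_derive_fejer_primitive n (phi x - phi t).
  have dv : is_derive t 1 (fun t => phi x - phi t) (- pk t).
    by apply: is_derive_eq; rewrite add0r mul1r.
  have dc := @is_derive1_comp R (fejer_primitive n) (fun t => phi x - phi t) t _ _ dP dv.
  rewrite (_ : F = (- (2 * pi)^-1) \*: (fejer_primitive n \o (fun t => phi x - phi t))).
    apply: is_derive_eq; rewrite /GRing.scale /= /phase_kernel; ring.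
  by apply/funext => s; rewrite /F /= /GRing.scale /=; ring.
have cF : continuous F by apply: derivable_continuous => t; case: (dF t).
rewrite (@continuous_FTC2 R _ F).
- rewrite /F; have -> : phi pi = phi (- pi) + 2 * pi.
    by rewrite -phaseD2pi; congr phase; ring.
  rewrite -EFinB; congr (_%:E).
  have -> : phi x - phi (- pi) = (phi x - (phi (- pi) + 2 * pi)) + 2 * pi by ring.
  rewrite fejer_primitiveD2pi; have := lt0r_neq0 pi2.
  by move: (2 * pi) => P P0; field.
- by rewrite -subr_gt0 opprK addr_gt0// pi_gt0.
- apply: continuous_subspaceT => t; apply: cvgM; last exact: cvg_cst.
  apply: cvgM; last exact: continuous_poissonr.
  apply: (@continuous_comp _ _ _ (fun t => phi x - phi t) (fejer n)); last exact: continuous_fejer.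
  by apply: cvgB; [exact: cvg_cst|exact: continuous_phase].
- split.
  + by move=> t _; case: (dF t).
  + by apply: cvg_at_right_filter; exact: cF.
  + by apply: cvg_at_left_filter; exact: cF.
- by move=> t _; rewrite derive1E; exact: (@derive_val _ _ _ _ _ _ _ (dF t)).
Qed.

Lemma phase_kernel_mean n x : \int[mu]_(t in D) phase_kernel n x t = 1.
Proof. by rewrite /Rintegral integral_phase_kernel. Qed.

(** As [F_n] is even, [K_n(x, t) = K_n(t, x) p(t) / p(x)], and the constant is
    the ratio of the upper and lower bounds of the Poisson kernel. *)
Lemma phase_kernel_adjoint n t :
  (\int[mu]_(x in D) (phase_kernel n x t)%:E <= (4 / (1 - r) ^+ 2)%:E)%E.
Proof.
pose C := 4 / (1 - r) ^+ 2.
have r1' : 0 < 1 - r by rewrite subr_gt0.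
have C0 : 0 <= C by rewrite divr_ge0// exprn_ge0// ltW.
have mk s : measurable_fun D (fun x => (phase_kernel n x s)%:E).
  apply/measurable_EFinP; apply: measurable_funTS.
  exact: (measurable_fun_pair1 s (measurable_phase_kernel n)).
have mk2 s : measurable_fun D (fun x => (phase_kernel n s x)%:E).
  apply/measurable_EFinP; apply: measurable_funTS.
  exact: (measurable_fun_pair2 s (measurable_phase_kernel n)).
rewrite -[leRHS]mule1 -(integral_phase_kernel n t) -ge0_integralZl ?lee_fin//; last 2 first.
- exact: mk2.
- by move=> x _; rewrite lee_fin phase_kernel_ge0.
apply: ge0_le_integral => //.
- by move=> x _; rewrite lee_fin phase_kernel_ge0.
- exact: mk.
- by apply: measurable_funeM; exact: mk2.
move=> x _; rewrite -EFinM lee_fin /phase_kernel.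
rewrite [leRHS]mulrA ler_pM2r ?invr_gt0// -[phi t - phi x]opprB fejerN.
rewrite [leRHS]mulrCA ler_wpM2l ?fejer_ge0//.
apply: le_trans (poissonr_le ta r0 r1 t) _.
apply: (@le_trans _ _ (C * ((1 - r ^+ 2) / 4))).
  rewrite /C le_eqVlt; apply/orP; left; apply/eqP; field.
  by rewrite gt_eqF.
by rewrite ler_wpM2l// poissonr_ge.
Qed.

Lemma one_minus_cos_ge (m s : R) : 0 <= m -> m <= `|s| -> `|s| <= 2 * pi - m ->
  1 - cos m <= 1 - cos s.
Proof.
move=> m0 ms sm; rewrite lerD2l lerN2.
rewrite -[cos s]cos_norm.
have mpi : m <= pi by lra.
have cos_le y z : 0 <= y -> y <= z -> z <= pi -> cos z <= cos y.
  move=> y0 yz zpi; have yI : y \in `[0, pi] by rewrite in_itv /= y0 (le_trans yz).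
  have zI : z \in `[0, pi] by rewrite in_itv /= zpi (le_trans y0).
  by rewrite leNgt ltr_cos// -leNgt.
have [spi|spi] := leP `|s| pi; first exact: cos_le.
have -> : cos `|s| = cos (2 * pi - `|s|).
  by rewrite -[RHS]cosN opprB -[RHS]cosD2pi -[pi *+ 2]mulr_natl subrK.
by apply: cos_le; lra.
Qed.

(** For [x] interior and [t] in the interval, [|x - t|] is at most
    [2 pi - (pi - |x|)], so [x] and [t] are also apart on the circle. *)
Lemma phase_kernel_concentrates x (d e : R) : - pi < x < pi -> 0 < d -> 0 < e ->
  \forall n \near \oo, forall t, D t -> d <= `|x - t| -> phase_kernel n x t <= e.
Proof.
move=> /andP[xl xr] d0 e0.
(* A lower bound for the distance between [x] and [t] on the circle. *)
pose m := Num.min d (pi - `|x|).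
have xpi : `|x| < pi by rewrite ltr_norml xl.
have m0 : 0 < m by rewrite lt_min d0 subr_gt0.
have mpi : m <= pi by rewrite ge_min lerBlDr lerDl normr_ge0 orbT.
pose q := (1 - r ^+ 2) / 4.
have q0 : 0 < q by rewrite divr_gt0// poisson_num_gt0.
pose eta := q * q * (1 - cos m).
have cm : 0 < 1 - cos m.
  by rewrite subr_gt0 -[ltRHS]cos0 ltr_cos// in_itv /= ?lexx ?pi_ge0 ?(ltW m0).
have eta0 : 0 < eta by rewrite mulr_gt0// mulr_gt0.
pose B := (1 - r ^+ 2) / (1 - r) ^+ 2.
near=> n => t Dt dt.
have h1 : eta <= 1 - cos (phi x - phi t).
  rewrite one_minus_cos_phase// ler_pM ?(ltW cm)//.
  - by rewrite mulr_ge0// ltW.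
  - by rewrite ler_pM ?(ltW q0)// poissonr_ge.
  - apply: one_minus_cos_ge; first exact: ltW.
      by rewrite (le_trans _ dt)// ge_min lexx.
    have tpi : `|t| <= pi by rewrite ler_norml; move: Dt; rewrite /= in_itv.
    apply: le_trans (ler_normB _ _) _.
    have : m <= pi - `|x| by rewrite ge_min lexx orbT.
    by move: tpi; lra.
have h2 := fejer_le n eta0 h1.
apply: (@le_trans _ _ (2 / eta / n.+1%:R * B / (2 * pi))).
  rewrite ler_pM2r ?invr_gt0// ler_pM ?fejer_ge0 ?poissonr_le//.
  by rewrite ltW// poissonr_gt0.
pose A := 2 / eta * B / (2 * pi).
have -> : 2 / eta / n.+1%:R * B / (2 * pi) = A / n.+1%:R by rewrite /A; ring.
rewrite ler_pdivrMr// mulrC -ler_pdivrMr// (@le_trans _ _ n%:R) ?ler_nat//.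
by near: n; exact: nbhs_infty_ger.
Unshelve. all: by end_near. Qed.
End PhaseKernel.

(** * Complex linearity of the componentwise integral *)

Section ComplexIntegral.
Context {R : realType}.
Local Notation mu := (@lebesgue_measure R).
Variables (D : set R) (mD : measurable D).
Implicit Types (g : R -> R[i]).

Definition cintegrable g :=
  mu.-integrable D (EFin \o (fun t => complex.Re (g t))) /\
  mu.-integrable D (EFin \o (fun t => complex.Im (g t))).

Lemma integrableMlr (h : R -> R) c : mu.-integrable D (EFin \o h) ->
  mu.-integrable D (EFin \o (fun t => h t * c)).
Proof.
move=> ih; rewrite (_ : _ \o _ = (fun t : R => (h t)%:E * c%:E)%E)//.
exact: integrableZr.
Qed.

Lemma integrableDr (h1 h2 : R -> R) : mu.-integrable D (EFin \o h1) ->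
  mu.-integrable D (EFin \o h2) -> mu.-integrable D (EFin \o (fun t => h1 t + h2 t)).
Proof.
move=> ih1 ih2; rewrite (_ : _ \o _ = (fun t : R => (h1 t)%:E + (h2 t)%:E)%E)//.
exact: integrableD.
Qed.

Lemma integrableBr (h1 h2 : R -> R) : mu.-integrable D (EFin \o h1) ->
  mu.-integrable D (EFin \o h2) -> mu.-integrable D (EFin \o (fun t => h1 t - h2 t)).
Proof.
move=> ih1 ih2; rewrite (_ : _ \o _ = (fun t : R => (h1 t)%:E - (h2 t)%:E)%E)//.
exact: integrableB.
Qed.

Lemma complex_ReD (x y : R[i]) : complex.Re (x + y) = complex.Re x + complex.Re y.
Proof. by case: x; case: y. Qed.
Lemma complex_ImD (x y : R[i]) : complex.Im (x + y) = complex.Im x + complex.Im y.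
Proof. by case: x; case: y. Qed.
Lemma complex_ReM (x y : R[i]) : complex.Re (x * y) =
  complex.Re x * complex.Re y - complex.Im x * complex.Im y.
Proof. by case: x; case: y. Qed.
Lemma complex_ImM (x y : R[i]) : complex.Im (x * y) =
  complex.Re x * complex.Im y + complex.Im x * complex.Re y.
Proof. by case: x; case: y. Qed.

Lemma cintegrableD g1 g2 : cintegrable g1 -> cintegrable g2 ->
  cintegrable (fun t => g1 t + g2 t).
Proof.
move=> [r1 i1] [r2 i2]; split.
  by under eq_fun do rewrite complex_ReD; exact: integrableDr.
by under eq_fun do rewrite complex_ImD; exact: integrableDr.
Qed.

Lemma cintegrableZ g c : cintegrable g -> cintegrable (fun t => g t * c).
Proof.
move=> [r1 i1]; split.
  by under eq_fun do rewrite complex_ReM; apply: integrableBr; exact: integrableMlr.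
by under eq_fun do rewrite complex_ImM; apply: integrableDr; exact: integrableMlr.
Qed.

Lemma cintegralD g1 g2 : cintegrable g1 -> cintegrable g2 ->
  cintegral D (fun t => g1 t + g2 t) = cintegral D g1 + cintegral D g2.
Proof.
move=> [r1 i1] [r2 i2]; rewrite /cintegral.
under [X in X +i* _]eq_Rintegral do rewrite complex_ReD.
under [X in _ +i* X]eq_Rintegral do rewrite complex_ImD.
by rewrite !RintegralD.
Qed.

Lemma cintegralZ g c : cintegrable g ->
  cintegral D (fun t => g t * c) = cintegral D g * c.
Proof.
move=> [r1 i1]; rewrite /cintegral.
under [X in X +i* _]eq_Rintegral do rewrite complex_ReM.
under [X in _ +i* X]eq_Rintegral do rewrite complex_ImM.
rewrite RintegralB ?RintegralD//; try exact: integrableMlr.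
by rewrite !RintegralZr//; case: c.
Qed.

Lemma cintegrable0 : cintegrable (fun=> 0).
Proof. by split; exact: integrable0. Qed.

Lemma cintegrable_sum (I : Type) (s : seq I) (g : I -> R -> R[i]) :
  (forall i, cintegrable (g i)) -> cintegrable (fun t => \sum_(i <- s) g i t).
Proof.
move=> ig; elim: s => [|i s IH].
  by under eq_fun do rewrite big_nil; exact: cintegrable0.
by under eq_fun do rewrite big_cons; exact: cintegrableD.
Qed.

Lemma cintegral_sum (I : Type) (s : seq I) (g : I -> R -> R[i]) :
  (forall i, cintegrable (g i)) ->
  cintegral D (fun t => \sum_(i <- s) g i t) = \sum_(i <- s) cintegral D (g i).
Proof.
move=> ig; elim: s => [|i s IH].
  rewrite big_nil (_ : (fun _ => _) = fun=> 0 * 0).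
    by rewrite cintegralZ ?mulr0//; exact: cintegrable0.
  by apply/funext => t; rewrite big_nil mulr0.
rewrite big_cons -IH -cintegralD//; last exact: cintegrable_sum.
by congr (cintegral D); apply/funext => t; rewrite big_cons.
Qed.
End ComplexIntegral.

(** * Exponential sums *)

Section Expi.
Context {R : realType}.
Implicit Types (x y u : R) (k n : nat).

Lemma expiD x y : expi (x + y) = expi x * expi y.
Proof.
rewrite /expi cosD sinD; apply/eqP; rewrite eq_complex /= eqxx /=.
by apply/eqP; ring.
Qed.

Lemma expi0 : expi 0 = 1 :> R[i].
Proof. by rewrite /expi cos0 sin0. Qed.

Lemma expiMn n x : expi (n%:R * x) = expi x ^+ n.
Proof.
elim: n => [|n IH]; first by rewrite mul0r expi0 expr0.
by rewrite -natr1 mulrDl mul1r expiD IH exprSr.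
Qed.

Lemma expi_neq0 x : expi x != 0.
Proof.
apply/eqP => h; have := expiD x (- x).
by rewrite subrr expi0 h mul0r => /eqP; rewrite oner_eq0.
Qed.

Lemma expiN x : expi (- x) = (expi x)^-1.
Proof.
apply: (mulfI (expi_neq0 x)).
by rewrite -expiD subrr expi0 divff// expi_neq0.
Qed.

Lemma expi_intmul (z : int) x y : expi x = expi y ->
  expi (z%:~R * x) = expi (z%:~R * y).
Proof.
move=> xy; case: z => n; first by rewrite -!pmulrn !expiMn xy.
by rewrite NegzE !mulrNz !mulNr -!pmulrn !expiN !expiMn xy.
Qed.

Lemma expi_addN x : expi x + expi (- x) = (2 * cos x)%:C.
Proof.
rewrite /expi cosN sinN; apply/eqP; rewrite eq_complex /= subrr eqxx andbT.
by apply/eqP; ring.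
Qed.

Lemma sum_expi_dirichlet k u :
  \sum_(0 <= j < k.*2.+1) expi ((j%:Z - k%:Z)%:~R * u) = (dirichlet k u)%:C.
Proof.
elim: k => [|k IH].
  rewrite big_nat1 subrr mul0r expi0.
  by rewrite /dirichlet big_ord0 mulr0 addr0.
rewrite doubleS big_nat_recl// big_nat_recr//=.
have -> : \sum_(0 <= i < k.*2.+1) expi ((i.+1%:Z - k.+1%:Z)%:~R * u) =
    (dirichlet k u)%:C.
  rewrite -IH; apply: eq_bigr => j _; congr expi; congr (_%:~R * _).
  by rewrite !intS; ring.
have -> : (0%:Z - k.+1%:Z)%:~R * u = - (k.+1%:R * u).
  by rewrite sub0r mulrNz mulNr -pmulrn.
have -> : (k.*2.+2%:Z - k.+1%:Z)%:~R * u = k.+1%:R * u.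
  congr (_ * _); rewrite [RHS]pmulrn; congr (_%:~R).
  by rewrite -addnn -addSn -addnS PoszD addrK.
rewrite dirichletS [RHS]rmorphD /= -expi_addN.
by rewrite addrCA [X in _ = _ + X]addrC.
Qed.

Lemma sum_expi_fejer n u :
  (n.+1%:R)^-1 * \sum_(0 <= k < n.+1)
    \sum_(0 <= j < k.*2.+1) expi ((j%:Z - k%:Z)%:~R * u) = (fejer n u)%:C.
Proof.
under eq_bigr do rewrite sum_expi_dirichlet.
rewrite /fejer rmorphM fmorphV rmorph_nat; congr (_ * _).
by rewrite raddf_sum big_mkord.
Qed.
End Expi.

(** * Fejer means as averages *)

Lemma normc_ge0 {R : realType} (z : R[i]) : 0 <= normc z.
Proof. by case: z => x y; rewrite sqrtr_ge0. Qed.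

Section Fourier.
Context {R : realType}.
Local Notation mu := (@lebesgue_measure R).
Local Notation D := (`[- pi, pi]%classic : set R).

(** Comparing exponentials avoids determining the multiple of [2 pi] by which
    the two phases differ. *)
Lemma expi_nonlinear_phase (a : R[i]) (ta : R) (theta : R -> R) (t : R) :
  normc a < 1 -> is_arg a ta -> nonlinear_phase a theta ->
  expi (theta t) = expi (phase (normc a) ta t).
Proof.
rewrite /is_arg => ha hta [_ htheta]; rewrite htheta.
have r0 := normc_ge0 a.
move: (normc a) ha hta r0 => r r1 -> r0 {htheta}.
have et : expi t = expi ta * expi (t - ta) by rewrite -expiD addrC subrK.
have ep : expi (phase r ta t) = expi ta * expi (phase r ta t - ta).
  by rewrite -expiD addrC subrK.
have den : (r%:C * expi ta)^* * expi t = r%:C * expi (t - ta).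
  rewrite et mulrA; congr (_ * _).
  rewrite /expi; apply/eqP; rewrite eq_complex /=; apply/andP; split; apply/eqP; last by ring.
  transitivity (r * (cos ta ^+ 2 + sin ta ^+ 2)); first by ring.
  by rewrite cos2Dsin2 mulr1.
rewrite den.
have den0 : 1 - r%:C * expi (t - ta) != 0.
  apply/eqP => /(congr1 (@complex.Re R)) /=.
  have := one_minus_rcos_gt0 r0 r1 (t - ta).
  by rewrite mul0r subr0 => /lt0r_neq0 /eqP.
apply: (canLR (mulfK den0)).
rewrite ep et -mulrA.
have -> : r%:C * expi ta = expi ta * r%:C by rewrite mulrC.
rewrite -mulrBr; congr (_ * _).
have D0 := lt0r_neq0 (poisson_den_gt0 ta r0 r1 t).
rewrite [in RHS]/expi; have [-> ->] := cos_sin_phase ta r0 r1 t.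
rewrite /expi; set c := cos (t - ta); set s := sin (t - ta).
have hs : s ^+ 2 = 1 - c ^+ 2 by exact: sin2cos2.
have hd : poisson_den r ta t = 1 - 2 * r * c + r ^+ 2 by [].
apply/eqP; rewrite eq_complex /=; apply/andP; split; apply/eqP.
  apply: (mulIf D0).
  transitivity (((1 + r ^+ 2) * c - 2 * r) * (1 - r * c) + (1 - r ^+ 2) * r * s ^+ 2).
    by rewrite hs hd; ring.
  by field.
apply: (mulIf D0); rewrite {1}hd.
by field.
Qed.

Variables (a : R[i]) (ta : R) (theta : R -> R).
Hypotheses (ha : normc a < 1) (hta : is_arg a ta) (htheta : nonlinear_phase a theta).
Local Notation r := (normc a).
Local Notation phi := (phase r ta).
Variable f : R -> R[i].
Hypotheses (ire : mu.-integrable D (EFin \o (fun t => complex.Re (f t))))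
  (iim : mu.-integrable D (EFin \o (fun t => complex.Im (f t)))).

Let r0 : 0 <= r. Proof. exact: normc_ge0. Qed.

Let mD : measurable D. Proof. exact: measurable_itv. Qed.

Lemma cintegrable_coef (k : int) :
  cintegrable D (fun t => f t * expi (- (k%:~R * theta t)) * (poisson a ta t)%:C).
Proof.
have mp : measurable_fun D (poissonr r ta).
  apply: measurable_funTS; apply: continuous_measurable_fun.
  exact: continuous_poissonr.
have bp : [bounded poissonr r ta x | x in D].
  exists ((1 - r ^+ 2) / (1 - r) ^+ 2); split; first exact: num_real.
  move=> x hx t _ /=; rewrite ger0_norm ?(ltW (poissonr_gt0 _ _ _ _))//.
  exact: le_trans (poissonr_le ta r0 ha t) (ltW hx).
have imul (h w : R -> R) : mu.-integrable D (EFin \o h) ->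
    measurable_fun setT w -> (forall t, `|w t| <= 1) ->
    mu.-integrable D (EFin \o (fun t => h t * w t)).
  move=> ih mw w1; rewrite (_ : _ \o _ = (EFin \o h) \* (EFin \o w))%E//.
  apply: integrableMl => //; first exact: measurable_funTS.
  exists 1; split; first exact: num_real.
  by move=> x hx t _ /=; rewrite (le_trans (w1 t))// ltW.
have imulp (h : R -> R) : mu.-integrable D (EFin \o h) ->
    mu.-integrable D (EFin \o (fun t => h t * poissonr r ta t)).
  move=> ih; rewrite (_ : _ \o _ = (EFin \o h) \* (EFin \o poissonr r ta))%E//.
  exact: integrableMl.
have mphi : measurable_fun setT (fun t => - (k%:~R * phi t)).
  apply: measurable_funN; apply: measurable_funM => //.
  by apply: continuous_measurable_fun; exact: continuous_phase.
have mc : measurable_fun setT (fun t => cos (- (k%:~R * phi t))).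
  exact: (measurableT_comp (continuous_measurable_fun (@continuous_cos R)) mphi).
have ms : measurable_fun setT (fun t => sin (- (k%:~R * phi t))).
  exact: (measurableT_comp (continuous_measurable_fun (@continuous_sin R)) mphi).
have eE t : expi (- (k%:~R * theta t)) = expi (- (k%:~R * phi t)).
  by rewrite !expiN (expi_intmul k (expi_nonlinear_phase t ha hta htheta)).
have c1 t : `|cos (- (k%:~R * phi t))| <= 1 by rewrite ler_norml cos_geN1 cos_le1.
have s1 t : `|sin (- (k%:~R * phi t))| <= 1 by rewrite ler_norml sin_geN1 sin_le1.
split.
  rewrite (_ : _ \o _ = EFin \o (fun t => (complex.Re (f t) * cos (- (k%:~R * phi t)) -
     complex.Im (f t) * sin (- (k%:~R * phi t))) * poissonr r ta t)).
    by apply: imulp; apply: integrableBr; try exact: imul.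
  by apply/funext => t; rewrite /comp eE !complex_ReM /= mulr0 subr0.
rewrite (_ : _ \o _ = EFin \o (fun t => (complex.Re (f t) * sin (- (k%:~R * phi t)) +
     complex.Im (f t) * cos (- (k%:~R * phi t))) * poissonr r ta t)).
  by apply: imulp; apply: integrableDr; try exact: imul.
by apply/funext => t; rewrite /comp eE !(complex_ReM, complex_ImM) /= mulr0 add0r.
Qed.

(** Linearity of the integral moves the finite sums inside, where they collapse
    to the Fejer kernel. *)
Lemma fejer_mean_kernel n x : fejer_mean a ta theta f n x =
  kernel_mean D (phase_kernel r ta n) (fun t => complex.Re (f t)) x +i*
  kernel_mean D (phase_kernel r ta n) (fun t => complex.Im (f t)) x.
Proof.
pose G k t := f t * expi (- (k%:~R * theta t)) * (poisson a ta t)%:C.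
pose c (k : int) : R[i] := (n.+1%:R)^-1 * ((2 * pi)^-1)%:C * expi (k%:~R * theta x).
have iG k : cintegrable D (G k) by exact: cintegrable_coef.
transitivity (cintegral D (fun t => \sum_(0 <= k < n.+1)
    \sum_(0 <= j < k.*2.+1) G (j%:Z - k%:Z) t * c (j%:Z - k%:Z))).
  rewrite cintegral_sum//; last first.
    by move=> k; apply: cintegrable_sum => // j; exact: cintegrableZ.
  rewrite /fejer_mean mulr_sumr; apply: eq_bigr => k _.
  rewrite cintegral_sum//; last by move=> j; exact: cintegrableZ.
  rewrite /partial_sum mulr_sumr; apply: eq_bigr => j _.
  rewrite cintegralZ// /coef -/(G _) /c; ring.
have E t : \sum_(0 <= k < n.+1) \sum_(0 <= j < k.*2.+1)
    G (j%:Z - k%:Z) t * c (j%:Z - k%:Z) = f t * (phase_kernel r ta n x t)%:C.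
  transitivity (f t * (poisson a ta t)%:C * ((2 * pi)^-1)%:C *
    ((n.+1%:R)^-1 * \sum_(0 <= k < n.+1) \sum_(0 <= j < k.*2.+1)
       expi ((j%:Z - k%:Z)%:~R * (phi x - phi t)))).
    rewrite mulrA mulr_sumr; apply: eq_bigr => k _.
    rewrite mulr_sumr; apply: eq_bigr => j _.
    rewrite mulrBr expiD !expiN /G /c.
    rewrite expiN -!(expi_intmul _ (expi_nonlinear_phase _ ha hta htheta)).
    ring.
  rewrite sum_expi_fejer -!mulrA -!rmorphM; congr (_ * _%:C).
  rewrite /phase_kernel -[poisson a ta t]/(poissonr r ta t).
  by move: (2 * pi)^-1 => q; ring.
transitivity (cintegral D (fun t => f t * (phase_kernel r ta n x t)%:C)).
  by congr (cintegral D); apply/funext => t; exact: E.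
rewrite /cintegral /kernel_mean; congr (_ +i* _); apply: eq_Rintegral => t _.
  by rewrite complex_ReM /= mulr0 subr0.
by rewrite complex_ImM /= mulr0 add0r.
Qed.
End Fourier.

(** * Convergence in norm *)

Lemma normc_le_ReIm {R : realType} (z : R[i]) :
  normc z <= `|complex.Re z| + `|complex.Im z|.
Proof.
case: z => x y /=; rewrite -[leRHS]ger0_norm ?addr_ge0// -sqrtr_sqr ler_wsqrtr//.
rewrite -[x ^+ 2]real_normK ?num_real// -[y ^+ 2]real_normK ?num_real//.
have := mulr_ge0 (normr_ge0 x) (normr_ge0 y); nra.
Qed.

Lemma Re_le_normc {R : realType} (z : R[i]) : `|complex.Re z| <= normc z.
Proof. by case: z => x y /=; rewrite -sqrtr_sqr ler_wsqrtr// lerDl sqr_ge0. Qed.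

Lemma Im_le_normc {R : realType} (z : R[i]) : `|complex.Im z| <= normc z.
Proof. by case: z => x y /=; rewrite -sqrtr_sqr ler_wsqrtr// lerDr sqr_ge0. Qed.

Lemma measurable_normc {R : realType} (g : R -> R[i]) :
  measurable_fun setT (fun t => complex.Re (g t)) ->
  measurable_fun setT (fun t => complex.Im (g t)) ->
  measurable_fun setT (fun t => normc (g t)).
Proof.
move=> mr mi.
rewrite (_ : (fun _ => _) = fun t =>
    Num.sqrt (complex.Re (g t) ^+ 2 + complex.Im (g t) ^+ 2)); last first.
  by apply/funext => t; case: (g t).
apply: (measurableT_comp (continuous_measurable_fun (@sqrt_continuous R))).
by apply: measurable_funD; exact: measurable_funX.
Qed.

Lemma circle_normE {R : realType} (p : R) (g : R -> R[i]) : circle_norm p g =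
  (((2 * pi)^-1%:E * Lp_mass `[(- pi)%R, pi%R] p (fun t => normc (g t))) `^ p^-1)%E.
Proof.
have -> : Lp_mass `[(- pi)%R, pi%R] p (fun t => normc (g t)) =
    (\int[lebesgue_measure]_(t in `[(- pi)%R, pi%R]) (normc (g t) `^ p)%R%:E)%E.
  by apply: eq_integral => t _; rewrite ger0_norm ?normc_ge0.
by [].
Qed.

Unset Implicit Arguments.

Theorem theorem10 (R : realType) (a : R[i]) (ta : R) (theta : R -> R)
    (ha : normc a < 1) (hta : is_arg a ta) (htheta : nonlinear_phase a theta)
    (p : R) (hp : 1 <= p) (f : R -> R[i]) (hf : in_Lp p f) :
  circle_norm p (fun x => f x - fejer_mean a ta theta f n x) @[n --> \oo]
    --> 0%E.
Proof.
case: hf => _ mre mim foo.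
have p0 : 0 < p by rewrite (lt_le_trans _ hp).
have pi2 : 0 < 2 * pi :> R by rewrite mulr_gt0// pi_gt0.
have r0 := normc_ge0 a.
pose D := `[- pi, pi]%classic : set R.
have mD : measurable D by exact: measurable_itv.
have npi : - pi < pi :> R by rewrite -subr_gt0 opprK addr_gt0// pi_gt0.
have muD : (lebesgue_measure D < +oo)%E.
  by rewrite lebesgue_measure_itv /= lte_fin npi ltry.
have mn := measurable_normc mre mim.
have nE z : `|normc z| = normc z :> R by rewrite ger0_norm ?normc_ge0.
have noo : (Lp_mass D p (fun t => normc (f t)) < +oo)%E.
  move: foo; rewrite circle_normE -/D !ltey; apply: contra => /eqP ->.
  by rewrite mulry gtr0_sg ?invr_gt0// mul1e poweRyr// invr_eq0 gt_eqF.
have roo : (Lp_mass D p (fun t => complex.Re (f t)) < +oo)%E.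
  apply: le_lt_trans noo; apply: Lp_mass_le => //; first exact: ltW.
  by move=> t _; rewrite nE Re_le_normc.
have ioo : (Lp_mass D p (fun t => complex.Im (f t)) < +oo)%E.
  apply: le_lt_trans noo; apply: Lp_mass_le => //; first exact: ltW.
  by move=> t _; rewrite nE Im_le_normc.
have ire := Lp_integrable mD muD hp mre roo.
have iim := Lp_integrable mD muD hp mim ioo.
pose K := phase_kernel (normc a) ta.
have K0 n x t : 0 <= K n x t by exact: phase_kernel_ge0.
have Km n : measurable_fun setT (fun z : R * R => K n z.1 z.2).
  exact: measurable_phase_kernel.
have Kb n x : exists B, forall t, K n x t <= B by exact: phase_kernel_bounded.
have C0 : 0 <= 4 / (1 - normc a) ^+ 2 by rewrite divr_ge0// exprn_ge0// subr_ge0 ltW.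
have cvg h : measurable_fun setT h -> (Lp_mass D p h < +oo)%E ->
    Lp_mass D p (fun t => h t - kernel_mean D (K n) h t) @[n --> \oo] --> 0%E.
  move=> mh hoo; apply: (@approximate_identity_Lp R (- pi) pi npi K (4 / (1 - normc a) ^+ 2)) => //.
  - by move=> n x; exact: phase_kernel_mean.
  - by move=> n t _; exact: phase_kernel_adjoint.
  - by move=> x d e; exact: phase_kernel_concentrates.
have /nneg_cvge0P rcv := cvg _ mre roo.
have /nneg_cvge0P icv := cvg _ mim ioo.
have mT n h : measurable_fun setT h -> lebesgue_measure.-integrable D (EFin \o h) ->
    measurable_fun setT (fun t => h t - kernel_mean D (K n) h t).
  by move=> mh ih; apply: measurable_funB => //; exact: measurable_kernel_mean.
apply/nneg_cvge0P => [n|e e0]; first exact: poweR_ge0.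
(* Undoes, in order, the root, the normalisation of the measure, and the factor
   [2 `^ p] and the sum of two terms in the triangle inequality. *)
pose q := e `^ p * (2 * pi) / 2 `^ p / 2.
have q0 : 0 < q by rewrite !divr_gt0 ?powR_gt0// mulr_gt0// powR_gt0.
have Hr := rcv (fun n => Lp_mass_ge0 _ _ _) _ q0.
have Hi := icv (fun n => Lp_mass_ge0 _ _ _) _ q0.
have [N _ HN] := filterI Hr Hi.
exists N => // n Nn.
have [hr hi] := HN n Nn.
pose g x := f x - fejer_mean a ta theta f n x.
have gr t : complex.Re (g t) = complex.Re (f t) -
    kernel_mean D (K n) (fun t => complex.Re (f t)) t.
  by rewrite /g (fejer_mean_kernel ha hta htheta); case: (f t).
have gi t : complex.Im (g t) = complex.Im (f t) -
    kernel_mean D (K n) (fun t => complex.Im (f t)) t.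
  by rewrite /g (fejer_mean_kernel ha hta htheta); case: (f t).
have mg : measurable_fun setT (fun t => normc (g t)).
  apply: measurable_normc.
    by under eq_fun do rewrite gr; exact: mT.
  by under eq_fun do rewrite gi; exact: mT.
have H : (Lp_mass D p (fun t => normc (g t)) <= (e `^ p * (2 * pi))%:E)%E.
  apply: le_trans (Lp_mass_le_add mD mg (mT n _ mre ire) (mT n _ mim iim) (ltW p0) _) _.
    by move=> t _; rewrite nE -gr -gi normc_le_ReIm.
  apply: (@le_trans _ _ ((2 `^ p)%:E * (q%:E + q%:E))%E).
    apply: lee_wpmul2l; first by rewrite lee_fin powR_ge0.
    exact: (leeD hr hi).
  rewrite -EFinD -EFinM lee_fin /q -splitr mulrC divfK// gt_eqF// powR_gt0//.
rewrite circle_normE -/g -/D.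
have -> : e%:E = ((e `^ p)%:E `^ p^-1)%E.
  by rewrite poweR_EFin -powRrM mulfV ?gt_eqF// powRr1// ltW.
apply: gt0_ler_poweR.
- by rewrite invr_ge0 ltW.
- by rewrite in_itv /= leey mule_ge0 ?lee_fin ?invr_ge0 ?(ltW pi2)// Lp_mass_ge0.
- by rewrite in_itv /= leey lee_fin powR_ge0.
- by rewrite lee_pdivrMl// muleC -EFinM.
Qed.
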